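(* There exist constants $c_0,k_0,\rho_0>0$ such that for all $k\ge k_0$ and all $\rho$ with $\rho_0\le\rho\le k\ln2-3\ln k$ the following hypothesis is untrue: ''For any $\varepsilon>0$ there is $\omega=\omega(\varepsilon,k,\rho,n)\ge1$ such that with high probability for all $1\le t\le n$ we have $|\mu_{x_t}(\Phi_{t-1},\omega)-M_{x_t}(\Phi_{t-1})|<\varepsilon$.''
   Context: Let $k\ge3$, $n>1$ be integers, $r>0$ real, $m=\lceil rn\rceil$, and $V=\{x_1,\dots,x_n\}$. $\Phi=\Phi_k(n,m)$ is the random $k$-CNF obtained by choosing a set of $m$ clauses of length $k$ over $V$ uniformly at random (there are $2^k\binom nk$ possible clauses). Put $\rho=kr/2^k$. Throughout $k,\rho$ are fixed and $n\to\infty$; $\omega$ is an integer. ''With high probability'' means with probability tending to $1$ as $n\to\infty$. $1/0$ represent true/false. Decimation process: given a satisfiable $\Phi$, let $\Phi_0=\Phi$. For $t=1,\dots,n$: let $M_{x_t}(\Phi_{t-1})$ be the fraction of all satisfying assignments of $\Phi_{t-1}$ in which $x_t$ takes the value $1$; set $\sigma(x_t)=1$ with probability $M_{x_t}(\Phi_{t-1})$ and $\sigma(x_t)=0$ otherwise; obtain $\Phi_t$ from $\Phi_{t-1}$ by substituting $\sigma(x_t)$ for $x_t$ and simplifying (delete all clauses that got satisfied, omit $x_t$ from all other clauses). In the hypothesis, the random formulas $\Phi_0,\Phi_1,\dots$ result from applying this process to the random formula $\Phi_k(n,m)$ conditioned on being satisfiable. The variable set of $\Phi_t$ is $V_t=\{x_{t+1},\dots,x_n\}$.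 Belief Propagation values $\mu_x(\Psi,\omega)$ for a CNF $\Psi$: the factor graph of $\Psi$ is the bipartite graph whose vertices are the variables and clauses of $\Psi$, each clause being adjacent to the variables occurring in it; $N(v)$ is the neighborhood of $v$. For a variable $x$ and $a\in N(x)$ let $\mathrm{sign}(x,a)=1$ if $x$ occurs in $a$ positively and $-1$ otherwise. The message space $M(\Psi)$ is the set of tuples $\mu=(\mu_{x\to a}(\zeta))_{x,\,a\in N(x),\,\zeta\in\{0,1\}}$ with $\mu_{x\to a}(\zeta)\in[0,1]$ and $\mu_{x\to a}(0)+\mu_{x\to a}(1)=1$. For $\mu\in M(\Psi)$ set $\mu_{a\to x}(\zeta)=1$ if $\zeta=(1+\mathrm{sign}(x,a))/2$, and otherwise $$\mu_{a\to x}(\zeta)=1-\prod_{y\in N(a)\setminus\{x\}}\mu_{y\to a}\left(\tfrac{1-\mathrm{sign}(y,a)}2\right).$$ Define $\mathrm{BP}(\mu)\in M(\Psi)$ by $$(\mathrm{BP}(\mu))_{x\to a}(\zeta)=\frac{\prod_{b\in N(x)\setminus\{a\}}\mu_{b\to x}(\zeta)}{\prod_{b\in N(x)\setminus\{a\}}\mu_{b\to x}(0)+\prod_{b\in N(x)\setminus\{a\}}\mu_{b\to x}(1)},$$ unless the denominator is zero, in which case the value is $\frac12$. Let $\mu[0]$ have all entries $\frac12$, and $\mu[\ell]=\mathrm{BP}(\mu[\ell-1])$ for $1\le\ell\le\omega$. With $\mu_{b\to x}(\zeta)[\omega]$ the clause-to-variable values computed from $\mu[\omega]$, $$\mu_x(\Psi,\omega)=\frac{\prod_{b\in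 N(x)}\mu_{b\to x}(1)[\omega]}{\prod_{b\in N(x)}\mu_{b\to x}(0)[\omega]+\prod_{b\in N(x)}\mu_{b\to x}(1)[\omega]},$$ unless the denominator is zero, in which case $\mu_x(\Psi,\omega)=\frac12$. *)

(* Defs.v *)
From HB Require Import structures.
From mathcomp Require Import all_boot all_order all_algebra.
From mathcomp Require Import all_classical all_reals all_analysis.

Set Implicit Arguments.
Unset Strict Implicit.
Unset Printing Implicit Defensive.

Import Order.TTheory GRing.Theory Num.Theory.
Import numFieldNormedType.Exports.

Local Open Scope ring_scope.

(* The variable x_t (1 <= t <= n) is the element of 'I_n of value t - 1. *)

(* [c x] is [None] if x does not occur in c, [Some true] if x occurs
   positively and [Some false] if x occurs negatively. *)
Definition clause (n : nat) := {ffun 'I_n -> option bool}.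

Definition occurs n (x : 'I_n) (c : clause n) : bool := c x != None.

Definition kclauses (k n : nat) : {set clause n} :=
  [set c : clause n | #|[set x | occurs x c]| == k].

(* [vars] matters because it shrinks during decimation, including when a
   variable occurs in no clause.  [clauses] is a list: clauses that become equal
   after simplification remain distinct vertices of the factor graph. *)
Record cnf (n : nat) := Cnf { vars : {set 'I_n}; clauses : seq (clause n) }.

Definition assignment (n : nat) := {ffun 'I_n -> bool}.

Definition sat_clause n (s : assignment n) (c : clause n) : bool :=
  [exists x, c x == Some (s x)].

(* An assignment of [vars Psi] is represented by its extension by 0 to 'I_n. *)
Definition sat_assignments n (Psi : cnf n) : {set assignment n} :=
  [set s : assignment n | [forall x, s x ==> (x \in vars Psi)]
                          && all (sat_clause s) (clauses Psi)].

Definition satisfiable n (Psi : cnf n) : bool :=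
  [exists s, s \in sat_assignments Psi].

Definition marginal (R : realType) n (Psi : cnf n) (x : 'I_n) : R :=
  #|[set s in sat_assignments Psi | s x]|%:R / #|sat_assignments Psi|%:R.

Definition omit n (x : 'I_n) (c : clause n) : clause n :=
  [ffun y => if y == x then None else c y].

Definition substitute n (x : 'I_n) (v : bool) (Psi : cnf n) : cnf n :=
  Cnf (vars Psi :\ x)
      [seq omit x c | c : clause n <- clauses Psi & c x != Some v].

(* Phi_t, given Phi_0 = Phi and the values sigma(x_1), ..., sigma(x_t). *)
Definition decimated n (Phi : cnf n) (sigma : assignment n) (t : nat) : cnf n :=
  foldl (fun Psi x => substitute x (sigma x) Psi) Phi (take t (enum 'I_n)).

Section BeliefPropagation.
Variables (R : realType) (n : nat) (Psi : cnf n).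

Let clause_vertex := 'I_(size (clauses Psi)).

Definition clause_at (a : clause_vertex) : clause n :=
  tnth (in_tuple (clauses Psi)) a.

Definition nbr_var (x : 'I_n) : {set clause_vertex} :=
  [set a | occurs x (clause_at a)].

Definition nbr_clause (a : clause_vertex) : {set 'I_n} :=
  [set y | occurs y (clause_at a)].

(* true for sign +1 and false for sign -1, so that (1 + sign) / 2 is [sign] and
   (1 - sign) / 2 is [~~ sign]. *)
Definition sign (x : 'I_n) (a : clause_vertex) : bool :=
  clause_at a x == Some true.

(* mu x a zeta is mu_{x -> a}(zeta); the values at pairs (x, a) that are not
   edges of the factor graph are never used at an edge. *)
Definition messages := 'I_n -> clause_vertex -> bool -> R.

Definition clause_to_var (mu : messages)
    (a : clause_vertex) (x : 'I_n) (zeta : bool) : R :=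
  if zeta == sign x a then 1
  else 1 - \prod_(y in nbr_clause a :\ x) mu y a (~~ sign y a).

(* p1 / (p0 + p1), or 1/2 when the denominator vanishes *)
Definition normalized (p0 p1 : R) : R :=
  if p0 + p1 == 0 then 2^-1 else p1 / (p0 + p1).

Definition BP (mu : messages) : messages := fun x a zeta =>
  let p z := \prod_(b in nbr_var x :\ a) clause_to_var mu b x z in
  normalized (p (~~ zeta)) (p zeta).

Definition BP_iter (l : nat) : messages := iter l BP (fun _ _ _ => 2^-1).

Definition BP_marginal (x : 'I_n) (omega : nat) : R :=
  let p z := \prod_(b in nbr_var x) clause_to_var (BP_iter omega) b x z in
  normalized (p false) (p true).

End BeliefPropagation.

Section DecimationProcess.
Variables (R : realType) (k n m : nat).

Definition formula_of (F : {set clause n}) : cnf n := Cnf [set: 'I_n] (enum F).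

Definition satisfiable_formulas : {set {set clause n}} :=
  [set F : {set clause n} | [&& F \subset kclauses k n, #|F| == m
                              & satisfiable (formula_of F)]].

(* conditional probability that the process started at Phi produces sigma *)
Definition decimation_weight (Phi : cnf n) (sigma : assignment n) : R :=
  \prod_(x < n) let M := marginal R (decimated Phi sigma x) x in
                if sigma x then M else 1 - M.

(* Joint law of (Phi_k(n,m), sigma).  Conditioning the uniform distribution on
   satisfiability gives the uniform distribution on [satisfiable_formulas]. *)
Definition process_law (w : {set clause n} * assignment n) : R :=
  if w.1 \in satisfiable_formulas
  then #|satisfiable_formulas|%:R^-1 * decimation_weight (formula_of w.1) w.2
  else 0.

Definition process_prob (E : pred ({set clause n} * assignment n)) : R :=
  \sum_(w | E w) process_law w.

End DecimationProcess.

(* x ranges over 'I_n: its value is t - 1 when x is x_t, so that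
   [decimated Phi sigma x] is Phi_{t-1}. *)
Definition BP_accurate (R : realType) n (eps : R) (omega : nat)
    (w : {set clause n} * assignment n) : bool :=
  [forall x : 'I_n,
     let Psi := decimated (formula_of w.1) w.2 x in
     `|BP_marginal R Psi x omega - marginal R Psi x| < eps].

(* m = ceil (r n), where r = 2^k rho / k *)
Definition num_clauses (R : realType) (k : nat) (rho : R) (n : nat) : nat :=
  `|Num.ceil (2 ^+ k * rho / k%:R * n%:R)|%N.

Definition BP_hypothesis (R : realType) (k : nat) (rho : R) : Prop :=
  forall eps : R, 0 < eps ->
  exists omega : nat -> nat,
    (forall n, (1 <= omega n)%N) /\
    ((fun n => @process_prob R k n (num_clauses k rho n)
                 (BP_accurate eps (omega n))) @ \oo --> (1 : R))%classic.

(* Main.v *)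
Require Import Defs.
From mathcomp Require Import all_classical all_reals all_analysis.
From mathcomp Require Import all_boot all_order all_algebra.
From mathcomp Require Import ring lra zify.

Set Implicit Arguments.
Unset Strict Implicit.
Unset Printing Implicit Defensive.

Import Order.TTheory GRing.Theory Num.Theory.
Import numFieldNormedType.Exports.

Local Open Scope ring_scope.

(** Belief Propagation is exact on trees only, and a sparse random formula
    contains, with probability bounded away from 0, a small component of its
    factor graph that is not a tree.  Such a component is already enough to
    refute the assertion that Belief Propagation is accurate with probability
    tending to 1.

    The component is a bicycle: two clauses a and b of length k that share
    exactly two variables x and y, both occurring positively in a and in b,
    while no other clause meets their 2k-2 variables.  When x is the first of
    these variables to be decimated, the component is still intact at that time
    ([decimated_off]).  Write q = 2^-(k-2) for the probability that the k-2
    private literals of a clause are all false.  The marginal of x is computed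
    inside the component and equals 2 / (3 + (1-q)^2), or 0 if the remaining
    formula is unsatisfiable ([bicycle_marginal_le]).  Belief Propagation
    returns 1 / (1 + (1-qu)^2), where u is the current value of the message
    around the cycle ([bicycle_BP_marginal]); all values of u lie between
    (2-q)/(4-q) and 1/2, which keeps the two numbers at least q^3/128 apart
    whatever the number of iterations ([bicycle_BP_gap]).

    It remains to see that a positive fraction of the satisfiable formulas with
    m clauses contain a bicycle.  Adding to a satisfiable formula a clause which
    one of its satisfying assignments satisfies, and deleting a clause, both
    keep the formula satisfiable; double counting these two moves compares the
    numbers of satisfiable formulas with different numbers of clauses, or over
    different sets of allowed clauses, up to constant factors
    ([sat_sets_succ], [sat_sets_del], [sat_sets_universe]).  So a given bicycle
    is present in at least a fraction of order n^-(2k-2), and a given pair of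
    bicycles in at most a fraction of order n^-(4k-4), of all satisfiable
    formulas.  There are of order n^(2k-2) possible bicycles, and the second
    moment method yields the claim ([isolated_config_positive_fraction]). *)

(** * Satisfiable sets of clauses *)

Lemma card_dep_pairs (S T : finType) (P : pred S) (Q : S -> pred T) :
  #|[set p : S * T | P p.1 && Q p.1 p.2]| = (\sum_(x | P x) #|[set y | Q x y]|)%N.
Proof.
rewrite -sum1_card.
under [RHS]eq_bigr => x _ do rewrite -sum1_card.
rewrite pair_big_dep; apply: eq_bigl => p.
by rewrite !inE.
Qed.

Definition sat_sets n (U : {set clause n}) (j : nat) : {set {set clause n}} :=
  [set F : {set clause n} | [&& F \subset U, #|F| == j
                              & satisfiable (formula_of F)]].

Lemma satisfiableP n (F : {set clause n}) :
  reflect (exists s, {in F, forall c, sat_clause s c})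
          (satisfiable (formula_of F)).
Proof.
apply: (iffP existsP) => -[s].
  rewrite inE => /andP[_ /allP h]; exists s => c cF.
  by apply: h; rewrite mem_enum.
move=> h; exists s; rewrite inE; apply/andP; split.
  by apply/forallP => x; rewrite inE implybT.
by apply/allP => c; rewrite mem_enum => /h.
Qed.

Lemma satisfiableS n (F G : {set clause n}) :
  F \subset G -> satisfiable (formula_of G) -> satisfiable (formula_of F).
Proof.
move=> /subsetP FG /satisfiableP[s h]; apply/satisfiableP; exists s => c /FG.
exact: h.
Qed.

Lemma sat_setsS n (U W : {set clause n}) j :
  U \subset W -> sat_sets U j \subset sat_sets W j.
Proof.
move=> UW; apply/subsetP => F; rewrite !inE => /and3P[FU -> ->].
by rewrite (subset_trans FU UW).
Qed.

(** Pairs of a satisfiable set and one of its clauses are counted twice; deleting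
    the clause loses no satisfiability. *)
Lemma sat_sets_del n (U : {set clause n}) j :
  (j.+1 * #|sat_sets U j.+1| <= #|sat_sets U j| * #|U|)%N.
Proof.
rewrite mulnC.
have -> : (#|sat_sets U j.+1| * j.+1 =
   #|[set p : {set clause n} * clause n | (p.1 \in sat_sets U j.+1) && (p.2 \in p.1)]|)%N.
  rewrite card_dep_pairs -sum_nat_const; apply: eq_bigr => F.
  rewrite inE => /and3P[_ /eqP <- _]; apply: eq_card => c; by rewrite inE.
rewrite -cardsX.
set D := [set p | _].
have inj : {in D &, injective (fun p : {set clause n} * clause n => (p.1 :\ p.2, p.2))}.
  move=> [F c] [G d]; rewrite !inE /= => /andP[_ cF] /andP[_ dG] [] FG cd.
  by rewrite -cd in dG FG *; rewrite -(setD1K cF) FG setD1K.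
rewrite -(card_in_imset inj); apply/subset_leq_card/subsetP => _ /imsetP[[F c] + ->].
rewrite !inE /= => /andP[/and3P[FU /eqP cF sF] cinF].
rewrite (subset_trans (subD1set _ _) FU) (satisfiableS (subD1set _ _) sF).
move: (cardsD1 c F); rewrite cF cinF add1n => -[] <-.
by rewrite eqxx /= (subsetP FU).
Qed.

(** The converse of the deletion count: every satisfiable set has a satisfying
    assignment, and each of the at least kap - j new clauses that this
    assignment satisfies may be added. *)
Lemma sat_sets_add n (U : {set clause n}) j (kap : nat) :
  (forall s, kap <= #|[set c in U | sat_clause s c]|)%N ->
  (#|sat_sets U j| * (kap - j) <= j.+1 * #|sat_sets U j.+1|)%N.
Proof.
move=> hk; rewrite [leqRHS]mulnC.
have -> : (#|sat_sets U j.+1| * j.+1 =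
   #|[set p : {set clause n} * clause n | (p.1 \in sat_sets U j.+1) && (p.2 \in p.1)]|)%N.
  rewrite card_dep_pairs -sum_nat_const; apply: eq_bigr => F.
  rewrite inE => /and3P[_ /eqP <- _]; apply: eq_card => c; by rewrite inE.
set D := [set p | _].
pose D' := [set p : {set clause n} * clause n | (p.1 \in sat_sets U j) &&
   ((p.2 \in U :\: p.1) && satisfiable (formula_of (p.2 |: p.1)))].
apply: (@leq_trans #|D'|).
  rewrite (card_dep_pairs (mem (sat_sets U j))
    (fun G c => (c \in U :\: G) && satisfiable (formula_of (c |: G)))) -sum_nat_const.
  apply: leq_sum => G; rewrite inE => /and3P[GU /eqP cG /satisfiableP[s sG]].
  apply: (@leq_trans #|[set c in U | sat_clause s c] :\: G|).
    rewrite cardsD leq_sub ?hk //.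
    by rewrite -cG subset_leq_card // subsetIr.
  apply/subset_leq_card/subsetP => c; rewrite !inE => /and3P[cnG cU sc].
  rewrite cnG cU /=; apply/satisfiableP; exists s => d.
  by rewrite !inE => /orP[/eqP->//|/sG].
have inj : {in D' &, injective (fun p : {set clause n} * clause n => (p.2 |: p.1, p.2))}.
  move=> [F c] [G d]; rewrite !inE /= => /andP[_ /andP[/andP[cF _] _]] /andP[_ /andP[/andP[dG _] _]] [] FG cd.
  rewrite -cd in dG FG *; congr (_, _).
  by rewrite -(setU1K cF) FG setU1K.
rewrite -(card_in_imset inj); apply/subset_leq_card/subsetP => _ /imsetP[[F c] + ->].
rewrite !inE /= => /andP[/and3P[FU /eqP cF sF] /andP[/andP[cnF cU] ->]].
by rewrite eqxx /= subUset sub1set cU FU cardsU1 cnF cF add1n eqxx.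
Qed.

(** Condition on whether c is used; if it is, delete it. *)
Lemma sat_sets_insert n (c : clause n) (U : {set clause n}) m :
  (#|sat_sets (c |: U) m.+1| <= #|sat_sets U m.+1| + #|sat_sets U m|)%N.
Proof.
pose C := [set F : {set clause n} | c \in F].
rewrite -(cardsID C) addnC leq_add //.
  apply/subset_leq_card/subsetP => F; rewrite !inE => /andP[cF /and3P[FU -> ->]].
  rewrite !andbT; apply/subsetP => d dF; move/subsetP: FU => /(_ _ dF).
  by rewrite !inE => /orP[/eqP dc|//]; rewrite -dc dF in cF.
have inj : {in sat_sets (c |: U) m.+1 :&: C &, injective (fun F => F :\ c)}.
  by move=> F G; rewrite !inE => /andP[_ cF] /andP[_ cG] FG; rewrite -(setD1K cF) FG setD1K.
rewrite -(card_in_imset inj); apply/subset_leq_card/subsetP => _ /imsetP[F + ->].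
rewrite !inE => /andP[/and3P[FU /eqP cF sF] cinF].
rewrite (satisfiableS (subD1set _ _) sF) andbT.
move: (cardsD1 c F); rewrite cF cinF add1n => -[] <-.
by rewrite eqxx andbT subDset.
Qed.

(** If every assignment satisfies at least kap clauses of U, the number of
    satisfiable sets grows by a factor of at least 1 / p with each clause
    added.  All bounds below hold with this single p, because enlarging the
    set of allowed clauses only increases the number of satisfied ones. *)
Section SatisfiableCounts.
Variables (R : realFieldType) (n : nat) (U : {set clause n}) (m kap : nat).
Hypothesis kapU : forall s, (kap <= #|[set c in U | sat_clause s c]|)%N.
Hypothesis m_kap : (m < kap)%N.
Let p : R := m%:R / (kap - m)%:R.

Lemma sat_sets_succ (W : {set clause n}) (j : nat) : U \subset W -> (j < m)%N ->
  #|sat_sets W j|%:R <= p * #|sat_sets W j.+1|%:R.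
Proof.
move=> UW jm.
have kapW s : (kap <= #|[set c in W | sat_clause s c]|)%N.
  apply: leq_trans (kapU s) _; apply/subset_leq_card/subsetP => c.
  by rewrite !inE => /andP[/(subsetP UW)-> ->].
have h := sat_sets_add j kapW.
rewrite /p mulrAC ler_pdivlMr ?ltr0n ?subn_gt0 // -!natrM ler_nat.
apply: leq_trans (leq_trans _ h) _; first by rewrite leq_mul2l leq_sub2l ?orbT // ltnW.
by rewrite leq_mul2r jm orbT.
Qed.

Lemma sat_sets_addn (W : {set clause n}) (i : nat) : U \subset W -> (i <= m)%N ->
  #|sat_sets W (m - i)|%:R <= p ^+ i * #|sat_sets W m|%:R.
Proof.
move=> UW; elim: i => [|i IH] im; first by rewrite subn0 mul1r.
have p0 : 0 <= p by rewrite divr_ge0.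
apply: le_trans (sat_sets_succ (j := m - i.+1) UW _) _; first by lia.
rewrite subnSK // exprS -mulrA ler_wpM2l // IH //; exact: ltnW.
Qed.

(** This is what bounds from below the probability that a given set of variables
    is isolated: the clauses of W outside U are allowed one at a time, and each
    enlarges the count by a factor of at most 1 + p. *)
Lemma sat_sets_universe (W : {set clause n}) : U \subset W -> (0 < m)%N ->
  #|sat_sets W m|%:R <= (1 + p) ^+ #|W :\: U| * #|sat_sets U m|%:R.
Proof.
move=> UW m0; have p0 : 0 <= p by rewrite divr_ge0.
have [d dW] : exists d, #|W :\: U| = d by exists #|W :\: U|.
elim: d W UW dW => [|d IH] W UW dW.
  rewrite dW mul1r ler_nat; apply/subset_leq_card/sat_setsS.
  by rewrite -setD_eq0 -cards_eq0 dW.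
have /card_gt0P[c cWU] : (0 < #|W :\: U|)%N by rewrite dW.
move: (cWU); rewrite inE => /andP[cU cW].
have UW' : U \subset W :\ c by rewrite subsetD1 UW cU.
have dW' : #|(W :\ c) :\: U| = d.
  rewrite (_ : _ :\: U = (W :\: U) :\ c); last by rewrite !setDDl setUC.
  by move: (cardsD1 c (W :\: U)); rewrite dW cWU add1n => -[].
rewrite dW exprS -mulrA -dW'.
apply: (@le_trans _ _ ((1 + p) * #|sat_sets (W :\ c) m|%:R)); last first.
  by rewrite ler_wpM2l ?addr_ge0 // IH.
rewrite -{1}(setD1K cW) mulrDl mul1r.
case: m m0 p p0 m_kap sat_sets_succ => // m' _ q q0 mk /(_ (W :\ c) m' UW' (ltnSn _)) h.
apply: (@le_trans _ _ (#|sat_sets (W :\ c) m'.+1| + #|sat_sets (W :\ c) m'|)%:R).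
  by rewrite ler_nat sat_sets_insert.
by rewrite natrD lerD2l.
Qed.

End SatisfiableCounts.

(** * Counting clauses of length k *)

Lemma card_bigcup_le (I T : finType) (P : pred I) (A : I -> {set T}) :
  (#|\bigcup_(i | P i) A i| <= \sum_(i | P i) #|A i|)%N.
Proof.
elim/big_rec2: _ => [|i a B _ IH]; first by rewrite cards0.
by apply: leq_trans (leq_card_setU _ _) _; rewrite leq_add2l.
Qed.

Definition touches n (S : {set 'I_n}) (c : clause n) : bool :=
  [exists x in S, occurs x c].

Definition clauses_off k n (S : {set 'I_n}) : {set clause n} :=
  [set c in kclauses k n | ~~ touches S c].

Lemma clauses_off_sub k n (S : {set 'I_n}) : clauses_off k S \subset kclauses k n.
Proof. by apply/subsetP => c; rewrite inE => /andP[]. Qed.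

(** A clause is determined by the sign of x in it and by what remains when x is
    omitted. *)
Lemma card_kclauses_occurs k n (x : 'I_n) :
  (#|[set c in kclauses k.+1 n | occurs x c]| <= 2 * #|kclauses k n|)%N.
Proof.
rewrite -card_bool -cardsT -cardsX.
have inj : {in [set c in kclauses k.+1 n | occurs x c] &,
    injective (fun c : clause n => (c x == Some true, omit x c))}.
  move=> c d; rewrite !inE /occurs => /andP[_ cx] /andP[_ dx] [cdx /ffunP cd].
  apply/ffunP => y; have := cd y; rewrite !ffunE; case: eqP => // -> _.
  by move: cx dx cdx; case: (c x) => [[]|] //; case: (d x) => [[]|].
rewrite -(card_in_imset inj); apply/subset_leq_card/subsetP => _ /imsetP[c + ->].
rewrite !inE /= => /andP[/eqP ck cx].
have -> : [set y | occurs y (omit x c)] = [set y | occurs y c] :\ x.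
  by apply/setP => y; rewrite !inE /occurs ffunE; case: (y == x).
by move: (cardsD1 x [set y | occurs y c]); rewrite ck inE cx add1n => /eqP; rewrite eqSS eq_sym.
Qed.

Lemma card_kclauses_le k n : (#|kclauses k n| <= (2 * n) ^ k)%N.
Proof.
elim: k => [|k IH].
  rewrite expn0 -(cards1 ([ffun=> None] : clause n)); apply/subset_leq_card/subsetP => c.
  rewrite !inE cards_eq0 => /eqP/setP hc; apply/eqP/ffunP => x; rewrite ffunE.
  by have := hc x; rewrite !inE /occurs; case: (c x).
have /subset_leq_card : kclauses k.+1 n \subset
    \bigcup_(x : 'I_n) [set c in kclauses k.+1 n | occurs x c].
  apply/subsetP => c cK; move: (cK); rewrite inE => /eqP ck.
  have /card_gt0P[x] : (0 < #|[set x | occurs x c]|)%N by rewrite ck.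
  by rewrite inE => xc; apply/bigcupP; exists x => //; rewrite inE cK.
move/leq_trans; apply; apply: leq_trans (card_bigcup_le _ _) _.
apply: (@leq_trans (\sum_(x : 'I_n) 2 * (2 * n) ^ k)).
  by apply: leq_sum => x _; apply: leq_trans (card_kclauses_occurs _ _) _; rewrite leq_mul2l.
by rewrite sum_nat_const card_ord mulnA expnS [(n * 2)%N]mulnC.
Qed.

Lemma card_clauses_touching k n (S : {set 'I_n}) :
  (#|kclauses k.+1 n :\: clauses_off k.+1 S| <= #|S| * (2 * (2 * n) ^ k))%N.
Proof.
have /subset_leq_card : kclauses k.+1 n :\: clauses_off k.+1 S \subset
    \bigcup_(x in S) [set c in kclauses k.+1 n | occurs x c].
  apply/subsetP => c; rewrite inE => /andP[+ cK]; rewrite inE cK negbK => /exists_inP[x xS xc].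
  by apply/bigcupP; exists x => //; rewrite inE cK.
move/leq_trans; apply; apply: leq_trans (card_bigcup_le _ _) _.
rewrite -sum_nat_const; apply: leq_sum => x _.
by apply: leq_trans (card_kclauses_occurs _ _) _; rewrite leq_mul2l card_kclauses_le.
Qed.

(** Each k-subset of the complement of S carries the clause all of whose
    literals are true under s. *)
Lemma card_sat_clauses_off k n (S : {set 'I_n}) (s : assignment n) : (0 < k)%N ->
  ('C(n - #|S|, k) <= #|[set c in clauses_off k S | sat_clause s c]|)%N.
Proof.
move=> k0; rewrite (_ : (n - #|S|)%N = #|~: S|); last first.
  by have := cardsC S; rewrite card_ord => h; rewrite -(addKn #|S| #|~: S|) h.
rewrite -cards_draws.
pose agree (A : {set 'I_n}) : clause n := [ffun x => if x \in A then Some (s x) else None].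
have occE A : [set x | occurs x (agree A)] = A.
  by apply/setP => x; rewrite inE /occurs ffunE; case: ifP.
have inj : injective agree by move=> A B AB; rewrite -[A]occE AB occE.
rewrite -(card_imset _ inj); apply/subset_leq_card/subsetP => _ /imsetP[A + ->].
rewrite !inE => /andP[AS /eqP Ak]; rewrite occE Ak eqxx /=; apply/andP; split.
  apply/exists_inP => -[x xS]; rewrite /occurs ffunE; case: ifP => // xA _.
  by move: (subsetP AS _ xA); rewrite inE xS.
have /card_gt0P[x xA] : (0 < #|A|)%N by rewrite Ak.
by apply/existsP; exists x; rewrite ffunE xA.
Qed.

(** * Bicycles in a formula *)

Definition supp n (c : clause n) : {set 'I_n} := [set x | occurs x c].

(** The cycle of the factor graph is x, a, y, b.  Minimality of x makes it the
    first variable of the component to be decimated. *)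
Record bicycle k n (a b : clause n) (x y : 'I_n) : Prop := Bicycle {
  bicycle_neq : x != y;
  bicycle_carda : #|supp a| = k;
  bicycle_cardb : #|supp b| = k;
  bicycle_meet : supp a :&: supp b = [set x; y];
  bicycle_ax : a x = Some true;
  bicycle_ay : a y = Some true;
  bicycle_bx : b x = Some true;
  bicycle_by : b y = Some true;
  bicycle_first : forall z, z \in supp a :|: supp b -> (x <= z)%N }.

Definition isolated_in n (F : {set clause n}) (a b : clause n) : bool :=
  [&& a \in F, b \in F &
      [forall c in F, touches (supp a :|: supp b) c ==> (c \in [set a; b])]].

Lemma isolated_inP n (F : {set clause n}) (a b c : clause n) z :
  isolated_in F a b -> c \in F -> occurs z c -> z \in supp a :|: supp b ->
  c \in [set a; b].
Proof.
move=> /and3P[_ _ /forall_inP h] cF zc zS; apply: (implyP (h c cF)).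
by apply/exists_inP; exists z.
Qed.

Lemma card_sat_sets_contain n (W D : {set clause n}) m :
  (#|[set F in sat_sets W (m + #|D|) | D \subset F]| <= #|sat_sets W m|)%N.
Proof.
have inj : {in [set F in sat_sets W (m + #|D|) | D \subset F] &,
            injective (fun F => F :\: D)}.
  move=> F G; rewrite !inE => /andP[_ DF] /andP[_ DG] FG.
  by rewrite -(setID F D) -(setID G D) FG (setIidPr DF) (setIidPr DG).
rewrite -(card_in_imset inj); apply/subset_leq_card/subsetP => _ /imsetP[F + ->].
rewrite !inE => /andP[/and3P[FW /eqP cF sF] DF].
rewrite (subset_trans (subsetDl _ _) FW) (satisfiableS (subsetDl _ _) sF) andbT /=.
by rewrite cardsD (setIidPr DF) cF addnK.
Qed.

(** Adding a and b to a satisfiable set that avoids their variables keeps it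
    satisfiable: making x true satisfies both and affects no other clause. *)
Lemma card_isolated_ge k n (a b : clause n) x y m : bicycle k a b x y -> a != b ->
  (#|sat_sets (clauses_off k (supp a :|: supp b)) m|
   <= #|[set F in sat_sets (kclauses k n) m.+2 | isolated_in F a b]|)%N.
Proof.
move=> [_ ka kb _ ax _ bx _ _] ab.
set U := clauses_off _ _.
have xS : x \in supp a :|: supp b by rewrite !inE /occurs ax.
have aU : a \notin U.
  by rewrite inE negb_and negbK; apply/orP; right; apply/exists_inP; exists x; rewrite // /occurs ax.
have bU : b \notin U.
  by rewrite inE negb_and negbK; apply/orP; right; apply/exists_inP; exists x; rewrite // /occurs bx.
have notin (G : {set clause n}) c : G \subset U -> c \notin U -> c \notin G.
  by move=> GU; apply: contra => /(subsetP GU).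
have abG (G : {set clause n}) : G \subset U -> a \notin b |: G.
  by move=> GU; rewrite !inE negb_or ab notin.
have inj : {in sat_sets U m &, injective (fun G => a |: (b |: G))}.
  move=> F G; rewrite !inE => /and3P[FU _ _] /and3P[GU _ _] FG.
  rewrite -(setU1K (notin _ _ FU bU)) -(setU1K (notin _ _ GU bU)).
  by rewrite -(setU1K (abG _ FU)) -(setU1K (abG _ GU)) FG.
rewrite -(card_in_imset inj); apply/subset_leq_card/subsetP => _ /imsetP[G + ->].
rewrite !inE => /and3P[GU /eqP cG /satisfiableP[s sG]].
rewrite !cardsU1 abG // notin // cG !add1n eqxx !subUset !sub1set !inE.
rewrite ka kb eqxx (subset_trans GU (clauses_off_sub _ _)) /=; apply/andP; split.
  apply/satisfiableP; exists [ffun z => if z == x then true else s z] => c.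
  rewrite !inE => /or3P[/eqP->|/eqP->|cG'].
  - by apply/existsP; exists x; rewrite ffunE eqxx ax.
  - by apply/existsP; exists x; rewrite ffunE eqxx bx.
  have /existsP[z /eqP cz] := sG _ cG'; apply/existsP; exists z; rewrite ffunE.
  have [zx|_] := eqVneq z x; last by rewrite cz.
  move: (subsetP GU _ cG'); rewrite inE => /andP[_ /exists_inP[]].
  by exists x; rewrite // /occurs -zx cz.
apply/and3P; split; rewrite ?inE ?eqxx ?orbT //.
apply/forall_inP => c; rewrite !inE => /or3P[->|->|/(subsetP GU)]; rewrite ?orbT ?implybT //.
by rewrite inE => /andP[_ /negPf ->].
Qed.

Lemma card_ord_lt M j : (j <= M)%N -> #|[set i : 'I_M | (i < j)%N]| = j.
Proof.
move=> jM; rewrite -sum1_card (eq_bigl (fun i : 'I_M => (i < j)%N)); last first.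
  by move=> i; rewrite inE.
by rewrite (big_ord_narrow jM) sum1_card card_ord.
Qed.

(** An explicit family of bicycles, indexed by functions: the variables are cut
    into 2k-2 blocks of length N, and g picks the i-th variable from the i-th
    block.  Blocks 0 and 1 hold the shared variables, so that x comes first.
    The private literals are positive in the first clause and negative in the
    second, which makes the two clauses of a bicycle distinguishable and the
    indexing injective. *)
Section Configurations.
Variables (k n N : nat).
Hypothesis k3 : (3 <= k)%N.
Hypothesis Nn : ((2 * k - 2) * N <= n)%N.
Implicit Types g h : {ffun 'I_(2 * k - 2) -> 'I_N}.
Implicit Types i j : 'I_(2 * k - 2).

Lemma config_var_subproof g i : (i * N + g i < n)%N.
Proof.
apply: leq_trans Nn; apply: (@leq_trans (i.+1 * N)).
  by rewrite (mulSnr i) ltn_add2l.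
by rewrite leq_mul2r ltn_ord orbT.
Qed.

Definition config_var g i : 'I_n := Ordinal (config_var_subproof g i).

Definition config_a g : clause n :=
  [ffun z => if [exists i : 'I_(2 * k - 2), (i < k)%N && (config_var g i == z)] then Some true else None].

Definition config_b g : clause n :=
  [ffun z => if [exists i : 'I_(2 * k - 2), (i < 2)%N && (config_var g i == z)] then Some true
             else if [exists i : 'I_(2 * k - 2), (k <= i)%N && (config_var g i == z)] then Some false
             else None].

Lemma config_var_inj g h i j : config_var g i = config_var h j -> i = j /\ g i = h j.
Proof.
move=> /(congr1 val) /= e.
have N0 : (0 < N)%N by apply: leq_trans (ltn_ord (g i)).
have ij : i = j.
  apply: val_inj; have := congr1 (divn^~ N) e.
  by rewrite /= !divnMDl // !divn_small // !addn0.
by split=> //; apply: val_inj; move: e; rewrite ij => /addnI.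
Qed.

Lemma supp_config_a g : supp (config_a g) = config_var g @: [set i : 'I_(2 * k - 2) | (i < k)%N].
Proof.
apply/setP => z; rewrite inE /occurs ffunE; case: existsP => [[i /andP[ik /eqP <-]]|nE].
  by rewrite imset_f // inE.
by apply/esym/imsetP => -[i]; rewrite inE => ik e; case: nE; exists i; rewrite ik e eqxx.
Qed.

Lemma supp_config_b g : supp (config_b g) =
  config_var g @: [set i : 'I_(2 * k - 2) | (i < 2)%N || (k <= i)%N].
Proof.
apply/setP => z; rewrite inE /occurs ffunE; case: existsP => [[i /andP[ik /eqP <-]]|nE].
  by rewrite imset_f // inE ik.
case: existsP => [[i /andP[ik /eqP <-]]|nE'].
  by rewrite imset_f // inE ik orbT.
apply/esym/imsetP => -[i]; rewrite inE => /orP[] ik e.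
  by case: nE; exists i; rewrite ik e eqxx.
by case: nE'; exists i; rewrite ik e eqxx.
Qed.

Lemma supp_config g : supp (config_a g) :|: supp (config_b g) = config_var g @: setT.
Proof.
rewrite supp_config_a supp_config_b -imsetU (_ : _ :|: _ = setT) //.
by apply/setP => i; rewrite !inE; case: leqP; rewrite ?orbT.
Qed.

Lemma config_aE g i : (i < k)%N -> config_a g (config_var g i) = Some true.
Proof.
by move=> ik; rewrite ffunE; case: existsP => // -[]; exists i; rewrite ik eqxx.
Qed.

Lemma config_bE g i : (i < 2)%N -> config_b g (config_var g i) = Some true.
Proof.
by move=> ik; rewrite ffunE; case: existsP => // -[]; exists i; rewrite ik eqxx.
Qed.

Lemma config_bN g i : (k <= i)%N -> config_b g (config_var g i) = Some false.
Proof.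
move=> ik; rewrite ffunE; case: existsP => [[j /andP[j2 /eqP/config_var_inj[ji _]]]|_].
  by rewrite ji in j2; lia.
by case: existsP => // -[]; exists i; rewrite ik eqxx.
Qed.

Fact config_x_subproof : (0 < 2 * k - 2)%N. Proof. lia. Qed.
Fact config_y_subproof : (1 < 2 * k - 2)%N. Proof. lia. Qed.
Definition config_x g := config_var g (Ordinal config_x_subproof).
Definition config_y g := config_var g (Ordinal config_y_subproof).

Lemma config_bicycle g :
  bicycle k (config_a g) (config_b g) (config_x g) (config_y g).
Proof.
have vinj : injective (config_var g) by move=> i j /config_var_inj[].
split.
- by apply/eqP => /vinj.
- by rewrite supp_config_a card_imset // card_ord_lt //; lia.
- rewrite supp_config_b card_imset //.
  have -> : [set i : 'I_(2 * k - 2) | (i < 2)%N || (k <= i)%N] =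
     [set i : 'I_(2 * k - 2) | (i < 2)%N] :|: ~: [set i : 'I_(2 * k - 2) | (i < k)%N].
    by apply/setP => i; rewrite !inE -leqNgt.
  rewrite cardsU disjoint_setI0 ?cards0 ?subn0; last first.
    by rewrite disjoints_subset; apply/subsetP => i; rewrite !inE; lia.
  rewrite card_ord_lt; last lia.
  have := cardsC [set i : 'I_(2 * k - 2) | (i < k)%N]; rewrite card_ord card_ord_lt; lia.
- rewrite supp_config_a supp_config_b -imsetI; last by move=> i j _ _ /vinj.
  rewrite -(imset_set1 (config_var g)) -(imset_set1 (config_var g)) -imsetU.
  rewrite (_ : _ :&: _ = [set Ordinal config_x_subproof] :|: [set Ordinal config_y_subproof]) //.
  apply/setP => i; rewrite !inE -!val_eqE /=; lia.
- by apply: config_aE => /=; lia.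
- by apply: config_aE => /=; lia.
- exact: config_bE.
- exact: config_bE.
- move=> z; rewrite supp_config => /imsetP[i _ ->] /=.
  case: i => -[|i] hi /=.
    by rewrite leq_add2l (_ : Ordinal _ = Ordinal hi) //; apply: val_inj.
  rewrite mul0n add0n (mulSn i); apply: leq_trans (ltnW (ltn_ord _)) _.
  by rewrite -addnA leq_addr.
Qed.

Lemma config_ab g h : config_a g != config_b h.
Proof.
have kM : (k < 2 * k - 2)%N by lia.
apply/eqP => /ffunP/(_ (config_var h (Ordinal kM))).
by rewrite config_bN // ffunE; case: ifP.
Qed.

Lemma config_inj g h : config_a g = config_a h -> config_b g = config_b h -> g = h.
Proof.
move=> ab bb; apply/ffunP => i.
have : config_var g i \in config_var h @: setT by rewrite -supp_config -ab -bb supp_config imset_f.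
by move=> /imsetP[j _ /config_var_inj[-> ->]].
Qed.

(** Two isolated bicycles that share a clause are equal: the shared clause
    contains the variable x of both, and isolation then forces the other
    clauses to agree as well. *)
Lemma config_isolated_notin (F : {set clause n}) g h : g != h ->
  isolated_in F (config_a g) (config_b g) -> isolated_in F (config_a h) (config_b h) ->
  (config_a h \notin [set config_a g; config_b g]) &&
  (config_b h \notin [set config_a g; config_b g]).
Proof.
move=> gh Eg /and3P[aF bF _].
rewrite !inE !negb_or config_ab [config_b h == config_a g]eq_sym config_ab !andbT /=.
have [_ _ _ _ ax _ bx _ _] := config_bicycle h.
have [_ _ _ _ agx _ bgx _ _] := config_bicycle g.
apply/andP; split; apply: contra gh => /eqP e; apply/eqP/esym.
  have := isolated_inP Eg bF (z := config_x h).
  rewrite /occurs bx !inE /occurs -e ax => /(_ isT isT).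
  by rewrite eq_sym (negPf (config_ab _ _)) => /eqP; apply: config_inj.
have := isolated_inP Eg aF (z := config_x h).
rewrite /occurs ax !inE /occurs -e bx orbT => /(_ isT isT).
by rewrite (negPf (config_ab _ _)) orbF => /eqP ?; apply: config_inj.
Qed.

Lemma card_config_isolated_le g m :
  (#|[set F in sat_sets (kclauses k n) m.+2 | isolated_in F (config_a g) (config_b g)]|
   <= #|sat_sets (kclauses k n) m|)%N.
Proof.
apply: leq_trans (card_sat_sets_contain _ [set config_a g; config_b g] _).
rewrite cards2 config_ab addn2; apply/subset_leq_card/subsetP => F.
by rewrite !inE subUset !sub1set => /andP[-> /and3P[-> ->]].
Qed.

Lemma card_config_isolated2_le g h m : g != h ->
  (#|[set F in sat_sets (kclauses k n) m.+4 |
      isolated_in F (config_a g) (config_b g) && isolated_in F (config_a h) (config_b h)]|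
   <= #|sat_sets (kclauses k n) m|)%N.
Proof.
move=> gh; set L := [set F in _ | _].
have [->|/set0Pn[F0 F0L]] := eqVneq L set0; first by rewrite cards0.
have /andP[ha hb] : (config_a h \notin [set config_a g; config_b g]) &&
  (config_b h \notin [set config_a g; config_b g]).
  by move: F0L; rewrite inE => /and3P[_ Eg Eh]; apply: config_isolated_notin Eg Eh.
apply: leq_trans (card_sat_sets_contain _
   (config_a h |: (config_b h |: [set config_a g; config_b g])) _).
have -> : #|config_a h |: (config_b h |: [set config_a g; config_b g])| = 4.
  by rewrite cardsU1 cardsU1 hb in_setU1 negb_or config_ab ha cards2 config_ab.
rewrite addn4.
apply/subset_leq_card/subsetP => F.
by rewrite !inE !subUset !sub1set => /andP[-> /andP[/and3P[-> -> _] /and3P[-> ->]]].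
Qed.

End Configurations.

(** * Belief Propagation on a bicycle *)

Section BPonBicycle.
Variables (R : realType) (k n : nat) (Psi : cnf n) (a b : clause n) (x y : 'I_n).
Hypothesis k3 : (3 <= k)%N.
Hypothesis ab : a != b.
Hypothesis bic : bicycle k a b x y.
Let S := supp a :|: supp b.
Hypothesis comp : perm_eq [seq c <- clauses Psi | touches S c] [:: a; b].

(** Locates the two clauses among the vertices of the factor graph.  The
    hypothesis comp on the list of clauses says that each occurs exactly once
    and that nothing else meets S. *)
Lemma bicycle_vertices : exists ia ib : 'I_(size (clauses Psi)),
  [/\ ia != ib, clause_at ia = a, clause_at ib = b &
      forall i, touches S (clause_at i) -> i = ia \/ i = ib].
Proof.
pose s := [seq i <- enum 'I_(size (clauses Psi)) | touches S (clause_at i)].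
have sE : map (@clause_at n Psi) s = [seq c <- clauses Psi | touches S c].
  rewrite -(filter_map (@clause_at n Psi) (touches S)); congr filter.
  exact: (map_tnth_enum (in_tuple (clauses Psi))).
have us : uniq s by rewrite filter_uniq // enum_uniq.
have ms i : touches S (clause_at i) -> i \in s by rewrite mem_filter mem_enum andbT.
clearbody s; move: comp; rewrite -sE => comp'.
have := perm_size comp'; rewrite size_map.
case: s us ms comp' {sE} => [|i [|j []]] //=; rewrite andbT inE => ij ms ci _.
have := perm_mem ci a; have := perm_mem ci b.
rewrite !inE !eqxx orbT /= => /orP[] /eqP bE /orP[] /eqP aE; first 1 last.
- exists j, i; rewrite eq_sym; split=> // l /ms; rewrite !inE => /orP[] /eqP; tauto.
- exists i, j; split=> // l /ms; rewrite !inE => /orP[] /eqP; tauto.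
- by move: ab; rewrite aE bE eqxx.
- by move: ab; rewrite aE bE eqxx.
Qed.

Let q : R := 2^-1 ^+ (k - 2).

(** By symmetry the four messages along the cycle, from x or y to a or b, give
    the value false one common weight, and every message from a private
    variable stays at 1/2; this is the recursion of that weight. *)
Fixpoint bp_message (l : nat) : R :=
  if l is l'.+1 then (1 - q * bp_message l') / (2 - q * bp_message l') else 2^-1.

Lemma leaf_factor_gt0 : 0 < q. Proof. by rewrite exprn_gt0 // invr_gt0. Qed.

Lemma leaf_factor_le : q <= 2^-1.
Proof.
have -> : q = 2^-1 * 2^-1 ^+ (k - 3) by rewrite -exprS; congr (_ ^+ _); lia.
by rewrite ler_piMr ?invr_ge0 // exprn_ile1 ?invr_ge0 // invf_le1 // ler1n.
Qed.

(** The update map is decreasing, so the interval between the image of 1/2 and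
    1/2 itself is mapped into itself. *)
Lemma bp_message_bounds l : (2 - q) / (4 - q) <= bp_message l <= 2^-1.
Proof.
have q0 := leaf_factor_gt0; have q1 := leaf_factor_le.
elim: l => [|l /andP[]] /=.
  rewrite lexx andbT ler_pdivrMr; lra.
set u := bp_message l => h1 h2.
have u0 : 0 <= u by apply: le_trans h1; rewrite divr_ge0; lra.
have qu : q * u <= q / 2 by rewrite ler_wpM2l // ltW.
have qu0 : 0 <= q * u by rewrite mulr_ge0 // ltW.
apply/andP; split; last by rewrite ler_pdivrMr; lra.
rewrite ler_pdivrMr; last lra.
rewrite mulrAC ler_pdivlMr; last lra.
nra.
Qed.

Lemma bp_message_denominator l : (1 + 1 - q * bp_message l == 0) = false.
Proof.
have q0 := leaf_factor_gt0; have q1 := leaf_factor_le; have /andP[h1 h2] := bp_message_bounds l.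
have u0 : 0 <= bp_message l by apply: le_trans h1; rewrite divr_ge0; lra.
apply/eqP; nra.
Qed.

(** The invariant of the iteration is stated for the messages that enter the
    products, namely those giving the weight of the falsifying value. *)
Lemma bicycle_BP_marginal omega :
  BP_marginal R Psi x omega = ((1 - q * bp_message omega) ^+ 2 + 1)^-1.
Proof.
have [ia [ib [iab iaE ibE touch]]] := bicycle_vertices.
have [xy ka kb meet ax ay bx by_ _] := bic.
have xS : x \in S by rewrite !inE /occurs ax.
have yS : y \in S by rewrite !inE /occurs ay.
pose I : {set 'I_(size (clauses Psi))} := [set ia; ib].
pose sh : {set 'I_n} := [set x; y].
have suppS (i : 'I_(size (clauses Psi))) z : i \in I -> z \in nbr_clause i -> z \in S.
  by rewrite !inE => /orP[] /eqP-> ; rewrite (iaE, ibE) => ->; rewrite ?orbT.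
have shI (i : 'I_(size (clauses Psi))) z : i \in I -> z \in sh -> clause_at i z = Some true.
  by rewrite !inE => /orP[] /eqP-> /orP[] /eqP->; rewrite ?iaE ?ibE.
have cardI (i : 'I_(size (clauses Psi))) : i \in I -> #|nbr_clause i| = k.
  by rewrite !inE /nbr_clause => /orP[] /eqP->; rewrite (iaE, ibE).
have nbrI z (i : 'I_(size (clauses Psi))) : z \in S -> i \in nbr_var Psi z -> i \in I.
  move=> zS; rewrite inE => zi; have : touches S (clause_at i) by apply/exists_inP; exists z.
  by rewrite !inE => /touch[] ->; rewrite eqxx ?orbT.
have nbr_sh z : z \in sh -> nbr_var Psi z = I.
  move=> zsh; have zS : z \in S by move: zsh; rewrite !inE => /orP[] /eqP->; rewrite /occurs ?ax ?ay.
  apply/setP => i; apply/idP/idP; first exact: nbrI.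
  by move=> iI; rewrite inE /occurs shI.
have nbr_leaf z (i : 'I_(size (clauses Psi))) : z \notin sh -> i \in I ->
    z \in nbr_clause i -> nbr_var Psi z = [set i].
  move=> zsh iI zi; have zS := suppS _ _ iI zi.
  apply/setP => j; rewrite [RHS]inE; apply/idP/eqP => [jz|->]; last first.
    by move: zi; rewrite !inE.
  have jI := nbrI _ _ zS jz; apply/eqP; apply: contraNT zsh => ji.
  rewrite /sh -meet; move: zi jz iI jI ji; rewrite !inE.
  by move=> zi zj /orP[] /eqP ? /orP[] /eqP ?; subst i j; move: zi zj; rewrite ?iaE ?ibE ?eqxx // => -> ->.
pose inv (mu : messages R Psi) u := forall i z, i \in I -> z \in nbr_clause i ->
  mu z i (~~ sign z i) = if z \in sh then u else 2^-1.
have ctv1 (mu : messages R Psi) i z : i \in I -> z \in sh -> clause_to_var mu i z true = 1 :> R.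
  by move=> iI zs; rewrite /clause_to_var /sign shI.
have ctv0 (mu : messages R Psi) u i z : inv mu u -> i \in I -> z \in sh ->
    clause_to_var mu i z false = 1 - q * u.
  move=> hmu iI zs; rewrite /clause_to_var {1}/sign shI //=; congr (1 - _).
  have shsub : sh \subset nbr_clause i.
    by apply/subsetP => w ws; rewrite inE /occurs shI.
  rewrite (eq_bigr (fun w => if w \in sh then u else 2^-1)); last first.
    by move=> w; rewrite in_setD1 => /andP[_ wi]; rewrite hmu.
  rewrite (bigID (mem sh)) /= mulrC; congr (_ * _).
    rewrite (eq_bigr (fun=> 2^-1)); last by move=> w /andP[_ /negPf ->].
    rewrite prodr_const /q; congr (_ ^+ _).
    transitivity #|nbr_clause i :\: sh|.
      apply: eq_card => w; rewrite [LHS]unfold_in !inE.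
      case: (w =P z) => [wz|_] /=; last by rewrite andbC.
      by move: zs; rewrite -wz !inE => ->.
    by rewrite cardsD (setIidPr shsub) cardI // cards2 xy.
  rewrite (eq_bigr (fun=> u)); last by move=> w /andP[_ ->].
  rewrite prodr_const -[RHS]expr1; congr (_ ^+ _).
  transitivity #|sh :\ z|.
    apply: eq_card => w; rewrite [LHS]unfold_in !in_setD1 -andbA; congr (_ && _).
    by have [wsh|_] := boolP (w \in sh); rewrite ?andbF // andbT (subsetP shsub).
  have := cardsD1 z sh; rewrite zs cards2 xy; lia.
have step (mu : messages R Psi) l : inv mu (bp_message l) -> inv (BP mu) (bp_message l.+1).
  move=> hmu i z iI zi; rewrite /BP /normalized negbK.
  have [zs|zs] := boolP (z \in sh).
    have -> : sign z i = true by rewrite /sign shI.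
    have [j jI jE] : exists2 j : 'I_(size (clauses Psi)), j \in I & nbr_var Psi z :\ i = [set j].
      rewrite nbr_sh //; move: iI; rewrite !inE => /orP[] /eqP->.
        exists ib; first by rewrite !inE eqxx orbT.
        by rewrite /I setU1K // inE.
      exists ia; first by rewrite !inE eqxx.
      by rewrite /I setUC setU1K // inE eq_sym.
    rewrite jE !big_set1 ctv1 // (ctv0 _ (bp_message l)) //.
    by rewrite addrA bp_message_denominator.
  by rewrite (nbr_leaf _ i) // setDv !big_set0 (pnatr_eq0 _ 2) mul1r.
have invl l : inv (@BP_iter R n Psi l) (bp_message l).
  elim: l => [|l IH]; last by rewrite /BP_iter iterS; apply: step.
  by move=> i z _ _ /=; rewrite if_same.
rewrite /BP_marginal nbr_sh ?inE ?eqxx // /I.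
rewrite !big_setU1 ?inE //= !big_set1.
have aI : ia \in I by rewrite !inE eqxx.
have bI : ib \in I by rewrite !inE eqxx orbT.
have xsh : x \in sh by rewrite !inE eqxx.
rewrite !ctv1 // !(ctv0 _ _ _ _ (invl omega)) // mulr1 -expr2 /normalized ifF ?mul1r //.
by apply/negbTE; rewrite gt_eqF // ltr_wpDl // sqr_ge0.
Qed.

(** The left side is largest at the lower end (2-q)/(4-q) of the range, where the
    exact difference of the two sides is positive of order q^3. *)
Lemma bp_message_sqr l :
  (1 - q * bp_message l) ^+ 2 <= (1 + (1 - q) ^+ 2) / 2 - q ^+ 3 / 32.
Proof.
have q0 := leaf_factor_gt0; have q1 := leaf_factor_le.
have /andP[] := bp_message_bounds l; set u := bp_message l => h1 h2.
have tt : 1 - q * u <= 1 - q * ((2 - q) / (4 - q)) by rewrite lerD2l lerN2 ler_wpM2l // ltW.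
have t0 : 0 <= 1 - q * u by nra.
apply: (@le_trans _ _ ((1 - q * ((2 - q) / (4 - q))) ^+ 2)).
  by rewrite ler_sqr ?nnegrE //; apply: le_trans tt.
have -> : 1 - q * ((2 - q) / (4 - q)) = (4 - 3 * q + q ^+ 2) / (4 - q) by field; lra.
rewrite exprMn exprVn ler_pdivrMr; last by rewrite exprn_gt0; lra.
rewrite -subr_ge0.
have -> : ((1 + (1 - q) ^+ 2) / 2 - q ^+ 3 / 32) * (4 - q) ^+ 2 - (4 - 3 * q + q ^+ 2) ^+ 2
  = q ^+ 3 * (2 ^-1 + q * (8 - q - 16) / 32) by field.
rewrite mulr_ge0 ?exprn_ge0 // ?ltW //; nra.
Qed.

Lemma bicycle_BP_gap omega (M : R) : M <= 2 / (3 + (1 - q) ^+ 2) ->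
  q ^+ 3 / 128 <= BP_marginal R Psi x omega - M.
Proof.
move=> hM; rewrite bicycle_BP_marginal.
have q0 := leaf_factor_gt0; have q1 := leaf_factor_le.
have := bp_message_sqr omega; set T := _ ^+ 2.
have T0 : 0 <= T by exact: sqr_ge0.
move=> Tle.
have c0 : 0 <= q ^+ 3 by rewrite exprn_ge0 // ltW.
have w0 : 0 <= (1 - q) ^+ 2 by exact: sqr_ge0.
have w1 : (1 - q) ^+ 2 <= 1 by rewrite exprn_ile1; lra.
move: hM Tle c0 w0 w1; move: (q ^+ 3) ((1 - q) ^+ 2) T T0 => c w T T0 hM Tle c0 w0 w1.
suff : c / 128 <= (T + 1)^-1 - 2 / (3 + w) by lra.
have -> : (T + 1)^-1 - 2 / (3 + w) = (1 + w - 2 * T) / ((T + 1) * (3 + w)).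
  by field; apply/andP; split; lra.
rewrite ler_pdivlMr; last by rewrite mulr_gt0; lra.
apply: (@le_trans _ _ (c / 128 * (2 * 4))); last lra.
by rewrite ler_wpM2l ?divr_ge0 // ler_pM; lra.
Qed.

End BPonBicycle.

(** * The marginal on a bicycle *)

Section Independence.
Variables (n : nat) (S : {set 'I_n}).
Implicit Types s t : assignment n.

Definition mix s t : assignment n := [ffun z => if z \in S then s z else t z].

(** Under a uniform assignment, events depending on disjoint sets of variables
    are independent: exchanging the values on S between two assignments is a
    bijection on pairs. *)
Lemma card_independent (P Q : pred (assignment n)) :
  (forall s t, {in S, s =1 t} -> P s = P t) ->
  (forall s t, {in ~: S, s =1 t} -> Q s = Q t) ->
  (#|[set s | P s && Q s]| * 2 ^ n = #|[set s | P s]| * #|[set s | Q s]|)%N.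
Proof.
move=> PS QS.
pose f (p : assignment n * assignment n) := (mix p.1 p.2, mix p.2 p.1).
have fK : involutive f.
  by move=> [s t]; rewrite /f /=; congr (_, _); apply/ffunP => z; rewrite !ffunE; case: (z \in S).
have cT : #|[set: assignment n]| = (2 ^ n)%N by rewrite cardsT card_ffun card_bool card_ord.
rewrite -cT -!cardsX -(card_preimset _ (inv_inj fK)); apply: eq_card => -[s t].
rewrite !inE /= andbT; congr (_ && _).
  by apply: PS => z zS; rewrite ffunE zS.
by apply: QS => z; rewrite inE ffunE => /negPf ->.
Qed.

End Independence.

Lemma sat_clause_eq n (c : clause n) (s t : assignment n) :
  {in supp c, s =1 t} -> sat_clause s c = sat_clause t c.
Proof.
move=> st; apply: eq_existsb => z.
have [cz|] := boolP (z \in supp c); first by rewrite st.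
by rewrite inE /occurs negbK => /eqP ->.
Qed.

Lemma card_unsat n (c : clause n) :
  (#|[set s | ~~ sat_clause s c]| * 2 ^ #|supp c| = 2 ^ n)%N.
Proof.
pose F z : pred bool := fun v => c z != Some v.
have -> : #|[set s | ~~ sat_clause s c]| = #|family F|.
  by apply: eq_card => s; rewrite !inE negb_exists; apply/forallP/familyP.
have cF z : #|F z| = (if occurs z c then 1 else 2)%N.
  rewrite /occurs -sum1_card big_mkcond big_bool /= !unfold_in /F.
  by case: (c z) => [[]|].
rewrite card_family foldrE big_map big_enum /=.
under eq_bigr do rewrite cF.
rewrite (bigID (fun z => occurs z c)) /= big1; last by move=> z ->.
rewrite mul1n (eq_bigr (fun=> 2)); last by move=> z /negPf ->.
rewrite prod_nat_const -expnD; congr (2 ^ _)%N.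
rewrite addnC -[RHS](card_ord n) -(cardsC (supp c)); congr (_ + _)%N.
by apply: eq_card => z; rewrite !inE unfold_in.
Qed.

Lemma sat_clause_occ n (c : clause n) (s : assignment n) x :
  c x = Some (s x) -> sat_clause s c.
Proof. by move=> cx; apply/existsP; exists x; rewrite cx. Qed.

Section BicycleMarginal.
Variables (R : realType) (k n : nat) (Psi : cnf n) (a b : clause n) (x y : 'I_n).
Hypothesis k3 : (3 <= k)%N.
Hypothesis bic : bicycle k a b x y.
Let S := supp a :|: supp b.
Hypothesis comp : perm_eq [seq c <- clauses Psi | touches S c] [:: a; b].
Hypothesis Svars : S \subset vars Psi.

Let X : R := 2 ^+ n.
Let q : R := 2^-1 ^+ (k - 2).

(** Inclusion and exclusion.  A clause of length j is falsified by a 2^-j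
    fraction of all assignments; a and b are consistent on their common
    variables, so both are falsified exactly when one merged clause of length
    2k-2 is. *)
Lemma card_bicycle_sat :
  #|[set s | sat_clause s a && sat_clause s b]|%:R = X * (3 + (1 - q) ^+ 2) / 4.
Proof.
have [xy ka kb meet ax ay bx by_ _] := bic.
pose A := [set s | ~~ sat_clause s a]; pose B := [set s | ~~ sat_clause s b].
pose c : clause n := [ffun z => if occurs z a then a z else b z].
have meetE z : occurs z a -> occurs z b -> a z = b z.
  move=> za zb; have : z \in [set x; y] by rewrite -meet !inE za.
  by rewrite !inE => /orP[] /eqP->; rewrite ?ax ?bx ?ay ?by_.
have ABE : A :&: B = [set s | ~~ sat_clause s c].
  apply/setP => s; rewrite !inE !negb_exists.
  apply/andP/forallP => [[/forallP ha /forallP hb] z|h].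
    by rewrite ffunE; case: ifP.
  split; apply/forallP => z; have := h z; rewrite ffunE.
    by case: ifPn => //; rewrite /occurs negbK => /eqP ->.
  case: ifPn => // za; have [zb|] := boolP (occurs z b); first by rewrite meetE.
  by rewrite /occurs negbK => /eqP ->.
have suppc : supp c = S.
  by apply/setP => z; rewrite !inE {1}/occurs ffunE; case: (boolP (occurs z a)).
have cardS : #|S| = (2 * k - 2)%N by rewrite cardsU ka kb meet cards2 xy mul2n -addnn.
have natE (D : {set assignment n}) j : (#|D| * 2 ^ j = 2 ^ n)%N -> #|D|%:R = X * 2^-1 ^+ j.
  move=> /(congr1 (fun i => i%:R : R)); rewrite natrM !natrX => e.
  by rewrite /X -e exprVn mulfK // expf_neq0.
have cA := natE _ _ (card_unsat a); have cB := natE _ _ (card_unsat b).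
have cAB := natE _ _ (card_unsat c); rewrite suppc cardS -ABE in cAB.
rewrite ka in cA; rewrite kb in cB.
have qk : 2^-1 ^+ k = q / 4 :> R.
  rewrite (_ : k = (k - 2) + 2)%N; last lia.
  by rewrite exprD; congr (_ * _); rewrite expr2 -invfM -natrM.
have qk2 : 2^-1 ^+ (2 * k - 2) = q ^+ 2 / 4 :> R.
  rewrite (_ : 2 * k - 2 = (k - 2) * 2 + 2)%N; last lia.
  by rewrite exprD exprM; congr (_ * _); rewrite expr2 -invfM -natrM.
have -> : [set s | sat_clause s a && sat_clause s b] = ~: (A :|: B).
  by apply/setP => s; rewrite !inE negb_or !negbK.
have : (#|A :|: B| + #|A :&: B| = #|A| + #|B|)%N.
  by rewrite cardsU subnK // (leq_trans (subset_leq_card (subsetIl _ _))) ?leq_addr.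
have := cardsC (A :|: B); rewrite card_ffun card_bool card_ord.
move=> /(congr1 (fun i => i%:R : R)); rewrite natrX natrD -/X => e1.
move=> /(congr1 (fun i => i%:R : R)); rewrite !natrD cA cB cAB qk qk2 => e2.
have -> : #|~: (A :|: B)|%:R = X - #|A :|: B|%:R by rewrite -e1 addrC addKr.
have -> : #|A :|: B|%:R = X * (q / 4) + X * (q / 4) - X * (q ^+ 2 / 4) by rewrite -e2 addrK.
by field.
Qed.

Lemma card_assignments_true : #|[set s : assignment n | s x]|%:R = X / 2.
Proof.
pose c : clause n := [ffun z => if z == x then Some false else None].
have sc : supp c = [set x].
  by apply/setP => z; rewrite !inE /occurs ffunE; case: (z == x).
have := card_unsat c; rewrite sc cards1 expn1 => /(congr1 (fun i => i%:R : R)).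
rewrite natrM natrX -/X => <-; rewrite mulfK //; congr (_ %:R); apply: eq_card => s.
rewrite !inE negb_exists; apply/idP/forallP => [sx z|/(_ x)].
  by rewrite ffunE; have [->|//] := eqVneq z x; rewrite sx.
by rewrite ffunE eqxx; case: (s x).
Qed.

(** The rest of the formula involves other variables, so by independence it
    cancels from the fraction, unless it is unsatisfiable and the fraction is
    0 by convention.  Assignments with x true satisfy both clauses. *)
Lemma bicycle_marginal_le : marginal R Psi x <= 2 / (3 + (1 - q) ^+ 2).
Proof.
have [xy ka kb meet ax ay bx by_ _] := bic.
pose P s := sat_clause s a && sat_clause s b.
pose Q (s : assignment n) := [forall z in ~: S, s z ==> (z \in vars Psi)] &&
  all (sat_clause s) [seq c <- clauses Psi | ~~ touches S c].
have satE : sat_assignments Psi = [set s | P s && Q s].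
  apply/setP => s; rewrite !inE.
  have -> : all (sat_clause s) (clauses Psi) = P s &&
      all (sat_clause s) [seq c <- clauses Psi | ~~ touches S c].
    rewrite -(perm_all _ (permEl (perm_filterC (touches S) (clauses Psi)))) all_cat.
    by rewrite (perm_all _ comp) /= andbT.
  rewrite andbCA; congr (_ && (_ && _)); apply/forallP/forall_inP => h z.
    by move=> _; apply: h.
  have [zS|zS] := boolP (z \in S); last by apply: h; rewrite inE.
  by rewrite (subsetP Svars) // implybT.
have PS (s t : assignment n) : {in S, s =1 t} -> P s = P t.
  by move=> st; congr (_ && _); apply: sat_clause_eq => z zc; apply: st; rewrite in_setU zc ?orbT.
have QS (s t : assignment n) : {in ~: S, s =1 t} -> Q s = Q t.
  move=> st; congr (_ && _).
    by apply: eq_forallb_in => z zS; rewrite st.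
  apply: eq_in_all => c; rewrite mem_filter => /andP[nt _]; apply: sat_clause_eq => z zc.
  apply: st; rewrite inE; apply: contra nt => zS; apply/exists_inP; exists z => //.
  by rewrite inE in zc.
have xS : x \in S by rewrite !inE /occurs ax.
have h1 := card_independent PS QS.
have h2 := @card_independent n S (fun s => s x) Q _ QS.
have {}h2 := h2 (fun (s t : assignment n) st => st x xS).
have e1 : #|[set s in sat_assignments Psi | s x]| = #|[set s : assignment n | s x && Q s]|.
  apply: eq_card => s; rewrite satE !inE andbC; case: (boolP (s x)) => //= sx.
  by rewrite /P (sat_clause_occ (x := x)) ?ax ?sx // (sat_clause_occ (x := x)) ?bx ?sx.
rewrite /marginal e1 satE.
move: h1 h2 => /(congr1 (fun i => i%:R : R)) h1 /(congr1 (fun i => i%:R : R)) h2.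
rewrite !natrM natrX card_bicycle_sat -/X in h1; rewrite !natrM natrX card_assignments_true -/X in h2.
have X0 : X != 0 by rewrite expf_neq0.
move: h1 h2; set p := #|[set s | P s & Q s]|%:R; set Qc := #|[set s | Q s]|%:R.
set p1 := #|[set s : assignment n | s x & Q s]|%:R => h1 h2.
have w0 : 0 < 3 + (1 - q) ^+ 2 by rewrite ltr_wpDr ?sqr_ge0.
have -> : p = Qc * (3 + (1 - q) ^+ 2) / 4.
  by apply: (mulIf X0); rewrite h1; ring.
have -> : p1 = Qc / 2 by apply: (mulIf X0); rewrite h2; ring.
have [->|Q0] := eqVneq Qc 0; first by rewrite !mul0r divr_ge0 // ltW.
rewrite le_eqVlt; apply/orP; left; apply/eqP; field.
by rewrite Q0 gt_eqF.
Qed.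

End BicycleMarginal.

(** * The decimation process *)

Section Decimation.
Variables (n : nat).
Implicit Types (F : {set clause n}) (S : {set 'I_n}) (s : assignment n).

Lemma substitute_off S (x : 'I_n) (v : bool) (Psi : cnf n) : x \notin S ->
  [seq c <- clauses (substitute x v Psi) | touches S c] =
  [seq omit x c | c : clause n <- [seq c <- clauses Psi | touches S c] & c x != Some v].
Proof.
move=> xS; rewrite /= filter_map -!filter_predI; congr map.
apply: eq_filter => c /=; rewrite andbC; congr (_ && _); apply: eq_existsb => z.
case: (boolP (z \in S)) => //= zS; rewrite /occurs ffunE.
by have [zx|//] := eqVneq z x; rewrite -zx zS in xS.
Qed.

(** Substituting for variables outside the component neither deletes nor
    shortens its clauses, and brings no other clause into contact with it. *)
Lemma decimated_off F a b s x :
  isolated_in F a b -> a != b -> supp a != set0 -> supp b != set0 ->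
  (forall z : 'I_n, z \in supp a :|: supp b -> (x <= z)%N) ->
  let Psi := decimated (formula_of F) s x in
  perm_eq [seq c <- clauses Psi | touches (supp a :|: supp b) c] [:: a; b] /\
  supp a :|: supp b \subset vars Psi.
Proof.
set S := supp a :|: supp b => iso ab a0 b0 hS.
have [aF bF _] := and3P iso.
have : {in take x (enum 'I_n), forall z, z \notin S}.
  move=> z /(map_f val); rewrite map_take val_enum_ord take_iota mem_iota /= => zx.
  by apply/negP => /hS; lia.
have : perm_eq [seq c <- clauses (formula_of F) | touches S c] [:: a; b] /\
    S \subset vars (formula_of F).
  split; last exact: subsetT.
  apply: uniq_perm; first by rewrite filter_uniq // enum_uniq.
    by rewrite /= inE ab.
  move=> c; rewrite mem_filter mem_enum !inE; apply/andP/orP => [[/exists_inP[z zS zc] cF]|].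
    by have := isolated_inP iso cF zc zS; rewrite !inE => /orP.
  have tS (d : clause n) : supp d \subset S -> supp d != set0 -> touches S d.
    move=> /subsetP dS /set0Pn[z zd]; apply/exists_inP; exists z; first exact: dS.
    by rewrite inE in zd.
  by case=> /eqP->; rewrite tS ?subsetUl ?subsetUr.
rewrite /decimated; elim: (take _ _) (formula_of F) => [|z l IH] Psi //= [hp hv] hl.
have zS : z \notin S by apply: hl; rewrite mem_head.
apply: IH => [|w wl]; last by apply: hl; rewrite inE wl orbT.
split; last by rewrite /= subsetD1 hv.
have za : a z = None by move: zS; rewrite !inE negb_or !negbK => /andP[/eqP].
have zb : b z = None by move: zS; rewrite !inE negb_or !negbK => /andP[_ /eqP].
have omitN (c : clause n) : c z = None -> omit z c = c.
  by move=> cz; apply/ffunP => w; rewrite ffunE; have [->|] := eqVneq w z.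
rewrite substitute_off //.
apply: perm_trans (perm_map _ (perm_filter _ hp)) _.
by rewrite /= za zb /= !omitN.
Qed.

End Decimation.

Section ChainRule.
Variables (R : realFieldType) (n : nat) (f : 'I_n -> assignment n -> R).
Hypothesis f_past : forall (x : 'I_n) (s t : assignment n),
  (forall z : 'I_n, (z < x)%N -> s z = t z) -> f x s = f x t.

(** The partial sums that keep only the first j factors drop by one half with
    each further factor: flipping the value of the j-th variable leaves the
    earlier factors unchanged and turns its own factor into the complement. *)
Lemma chain_rule :
  \sum_(s : assignment n) \prod_(x < n) (if s x then f x s else 1 - f x s) = 1.
Proof.
pose w x (s : assignment n) := if s x then f x s else 1 - f x s.
pose G j (s : assignment n) := \prod_(x < n | (x < j)%N) w x s.
suff h : forall j, (j <= n)%N -> (\sum_s G j s) * 2 ^+ j = 2 ^+ n.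
  have X0 : 2 ^+ n != 0 :> R by rewrite expf_neq0.
  apply: (mulIf X0); rewrite mul1r -[RHS](h n (leqnn _)); congr (_ * _).
  by apply: eq_bigr => s _; apply: eq_bigl => x; rewrite ltn_ord.
elim=> [_|j IH jn].
  rewrite mulr1 (eq_bigr (fun=> 1)); last by move=> s _; rewrite /G big_pred0.
  by rewrite sumr_const card_ffun card_bool card_ord natrX.
rewrite -(IH (ltnW jn)) exprS mulrA; congr (_ * _).
pose x := Ordinal jn.
pose flip (s : assignment n) : assignment n := [ffun z => if z == x then ~~ s z else s z].
have flipK : involutive flip.
  by move=> s; apply/ffunP => z; rewrite !ffunE; case: eqP => // _; rewrite negbK.
have GS s : G j.+1 s = w x s * G j s.
  rewrite /G (bigD1 x) //=; congr (_ * _); apply: eq_bigl => z.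
  by rewrite -val_eqE /=; lia.
have Gflip s : G j (flip s) = G j s.
  apply: eq_bigr => z zj; rewrite /w ffunE -val_eqE /= (ltn_eqF zj).
  have -> // : f z (flip s) = f z s.
  by apply: f_past => z' zz; rewrite ffunE -val_eqE /= (ltn_eqF (ltn_trans zz zj)).
have wflip s : w x s + w x (flip s) = 1.
  have e : f x (flip s) = f x s.
    by apply: f_past => z zx; rewrite ffunE -val_eqE (ltn_eqF zx).
  rewrite /w ffunE eqxx e; case: (s x) => /=; first by rewrite addrC subrK.
  by rewrite subrK.
rewrite mulr_natr mulr2n {2}(reindex_inj (inv_inj flipK)) -big_split /=.
apply: eq_bigr => s _.
by rewrite !GS Gflip -mulrDl wflip mul1r.
Qed.

End ChainRule.

Section Process.
Variables (R : realType) (k n m : nat).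

Lemma decimated_past (Phi : cnf n) (x : 'I_n) (s t : assignment n) :
  (forall z : 'I_n, (z < x)%N -> s z = t z) -> decimated Phi s x = decimated Phi t x.
Proof.
move=> st; rewrite /decimated.
have : {in take x (enum 'I_n), s =1 t}.
  move=> z /(map_f val); rewrite map_take val_enum_ord take_iota mem_iota /= => zx.
  by apply: st; lia.
elim: (take _ _) Phi => //= z l IH Phi h; rewrite h ?mem_head //; apply: IH.
by move=> w wl; apply: h; rewrite inE wl orbT.
Qed.

Lemma marginal_itv (Psi : cnf n) x : 0 <= marginal R Psi x <= 1.
Proof.
rewrite /marginal divr_ge0 //=.
have [->|n0] := eqVneq #|sat_assignments Psi| 0%N; first by rewrite invr0 mulr0.
rewrite ler_pdivrMr ?ltr0n ?lt0n // mul1r ler_nat subset_leq_card //.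
by apply/subsetP => s; rewrite inE => /andP[].
Qed.

Lemma decimation_weight_ge0 (Phi : cnf n) s : 0 <= decimation_weight R Phi s.
Proof.
apply: prodr_ge0 => x _ /=; have /andP[h1 h2] := marginal_itv (decimated Phi s x) x.
by case: (s x) => //; rewrite subr_ge0.
Qed.

Lemma sum_decimation_weight (Phi : cnf n) :
  \sum_s decimation_weight R Phi s = 1.
Proof.
rewrite -[RHS](@chain_rule R n (fun x s => marginal R (decimated Phi s x) x)) //.
by move=> x s t st; rewrite (decimated_past _ st).
Qed.

(** The conditional law of the decimation given the formula has total mass 1, so
    formulas on which the event never happens can be discarded. *)
Lemma process_prob_le (E : pred ({set clause n} * assignment n))
    (B : {set {set clause n}}) (c : R) : c <= 1 ->
  (forall F s, F \in B -> ~~ E (F, s)) ->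
  c * #|satisfiable_formulas k n m|%:R <= #|satisfiable_formulas k n m :&: B|%:R ->
  process_prob R k m E <= 1 - c.
Proof.
move=> c1 BE hc; rewrite /process_prob /process_law.
set Sat := satisfiable_formulas k n m in hc *.
rewrite -big_mkcondr /=.
apply: (@le_trans _ _ (\sum_(F in Sat :\: B) \sum_s
    #|Sat|%:R^-1 * decimation_weight R (formula_of F) s)).
  rewrite pair_big /= [leLHS]big_mkcond [leRHS]big_mkcond /=; apply: ler_sum => -[F s] _ /=.
  rewrite andbT in_setD -/(satisfiable_formulas k n m) -/Sat.
  have w0 : 0 <= #|Sat|%:R^-1 * decimation_weight R (formula_of F) s.
    by rewrite mulr_ge0 ?invr_ge0 ?decimation_weight_ge0.
  case: (boolP (F \in B)) => FB /=; first by rewrite (negPf (BE _ _ FB)).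
  by case: (F \in Sat); rewrite ?andbT ?andbF //; case: ifP.
under eq_bigr => F _ do rewrite -mulr_sumr sum_decimation_weight mulr1.
rewrite sumr_const -[leLHS]mulr_natl.
have [s0|s0] := posnP #|Sat|; first by rewrite s0 mulr0n invr0 mulr0 subr_ge0.
rewrite ler_pdivrMr ?ltr0n // mulrBl mul1r.
have := cardsID B Sat => /(congr1 (fun i => i%:R : R)); rewrite natrD; lra.
Qed.

End Process.

Lemma isolated_bicycle_not_accurate (R : realType) k n (F : {set clause n}) a b x y s omega :
  (3 <= k)%N -> a != b -> bicycle k a b x y -> isolated_in F a b ->
  ~~ BP_accurate ((2^-1 ^+ (k - 2)) ^+ 3 / 128 : R) omega (F, s).
Proof.
move=> k3 ab bic iso.
have nz (c : clause n) : #|supp c| = k -> supp c != set0 by rewrite -card_gt0 => ->; lia.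
have [] := decimated_off s iso ab (nz _ (bicycle_carda bic)) (nz _ (bicycle_cardb bic)) (bicycle_first bic).
set Psi := decimated _ _ _ => comp Sv.
apply/negP => /forallP/(_ x) /=; rewrite -/Psi.
have := bicycle_BP_gap k3 ab bic comp omega (bicycle_marginal_le R k3 bic comp Sv).
move=> h; apply/negP; rewrite -leNgt; apply: le_trans h _; exact: ler_norm.
Qed.

(** * A positive fraction of the satisfiable formulas contain a bicycle *)

(** For the number X of events that hold at F, the square of 1 - lam X is
    nonnegative, so 2 lam X - lam^2 X^2 is at most 1, and it is 0 where X = 0. *)
Lemma second_moment (R : realFieldType) (T I : finType) (A : {set T})
    (E : I -> pred T) (lam : R) :
  2 * lam * (\sum_g #|[set F in A | E g F]|%:R)
  - lam ^+ 2 * (\sum_g \sum_h #|[set F in A | E g F && E h F]|%:R)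
  <= #|[set F in A | [exists g, E g F]]|%:R.
Proof.
have cE (P : pred T) : #|[set F in A | P F]|%:R = \sum_(F in A) (P F)%:R :> R.
  rewrite -sum1_card natr_sum.
  rewrite (eq_bigl (fun F => (F \in A) && P F)); last by move=> F; rewrite inE.
  by rewrite big_mkcondr; apply: eq_bigr => F _; case: (P F).
under eq_bigr => g _ do rewrite cE.
under [in X in _ - X]eq_bigr => g _ do under eq_bigr => h _ do rewrite cE.
rewrite cE exchange_big /=.
under [in X in _ - X]eq_bigr => g _ do rewrite exchange_big /=.
rewrite [in X in _ - X]exchange_big /=.
rewrite !mulr_sumr -sumrB; apply: ler_sum => F _.
set X := \sum_g (E g F)%:R.
have -> : \sum_g \sum_h (E g F && E h F)%:R = X ^+ 2 :> R.
  rewrite expr2 /X mulr_suml; apply: eq_bigr => g _; rewrite mulr_sumr.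
  by apply: eq_bigr => h _; rewrite -natrM mulnb.
case: existsP => [_|nE].
  have : 0 <= (1 - lam * X) ^+ 2 by rewrite sqr_ge0.
  by rewrite (_ : (nat_of_bool true)%:R = 1) // -subr_ge0; congr (0 <= _); ring.
rewrite /X big1 ?mulr0 ?expr0n /= ?mulr0 ?subr0 // => g _.
by case: (boolP (E g F)) => // h; case: nE; exists g.
Qed.

(** The second moment method for one value of n, with al a lower bound for the
    expected number of isolated configurations and be an upper bound for the
    number of configurations times the bound p^2 on the probability of a single
    one. *)
Lemma isolated_config_fraction (R : realType) k n N m kap (al be : R)
    (k3 : (3 <= k)%N) (Nn : ((2 * k - 2) * N <= n)%N) :
  let W := kclauses k n in
  let p : R := m.+4%:R / (kap - m.+4)%:R in
  let Q : R := N%:R ^+ (2 * k - 2) in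
  (m.+4 < kap)%N -> (kap <= 'C(n - (2 * k - 2), k))%N -> (0 < n)%N ->
  0 < be ->
  al <= Q * (m.+4%:R * m.+3%:R) / (2 * n%:R) ^+ (2 * k) /
     (1 + p) ^+ ((2 * k - 2) * (2 * (2 * n) ^ k.-1)) ->
  Q * p ^+ 2 <= be ->
  0 <= al ->
  al ^+ 2 / (be + be ^+ 2) * #|sat_sets W m.+4|%:R <=
  #|[set F in sat_sets W m.+4 | [exists g, isolated_in F (config_a Nn g) (config_b Nn g)]]|%:R.
Proof.
move=> W p Q mkap kapC n0 be0 hal hbe al0.
set sig : R := #|sat_sets W m.+4|%:R.
pose E g F := isolated_in F (config_a Nn g) (config_b Nn g).
have p0 : 0 <= p by rewrite divr_ge0.
have Q0 : 0 <= Q by rewrite exprn_ge0.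
have sig0 : 0 <= sig by [].
have card_g : #|{ffun 'I_(2 * k - 2) -> 'I_N}|%:R = Q by rewrite card_ffun !card_ord natrX.
have kapW s : (kap <= #|[set c in W | sat_clause s c]|)%N.
  apply: leq_trans kapC _; apply: (@leq_trans #|[set c in clauses_off k set0 | sat_clause s c]|).
    apply: leq_trans (card_sat_clauses_off set0 s (leq_trans _ k3)) => //.
    by rewrite leq_bin2l // cards0 subn0 leq_subr.
  apply/subset_leq_card/subsetP => c; rewrite !inE => /andP[/andP[-> _] ->]; exact: isT.
have lower g : al * sig <= Q * #|[set F in sat_sets W m.+4 | E g F]|%:R.
  pose S := supp (config_a Nn g) :|: supp (config_b Nn g).
  pose U := clauses_off k S.
  have cS : #|S| = (2 * k - 2)%N.
    rewrite /S supp_config card_imset ?cardsT ?card_ord //.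
    by move=> i j /config_var_inj[].
  have kapU s : (kap <= #|[set c in U | sat_clause s c]|)%N.
    by apply: leq_trans kapC _; rewrite -cS card_sat_clauses_off //; lia.
  have UW : U \subset W by exact: clauses_off_sub.
  have := sat_sets_universe R kapU mkap UW (ltn0Sn _).
  rewrite -/p -/sig => h1.
  have cWU : (#|W :\: U| <= (2 * k - 2) * (2 * (2 * n) ^ k.-1))%N.
    by have := card_clauses_touching k.-1 S; rewrite cS prednK //; lia.
  have Ule : #|U|%:R <= (2 * n%:R) ^+ k :> R.
    rewrite -natrM -natrX ler_nat; apply: leq_trans (card_kclauses_le k n).
    exact: subset_leq_card.
  have d1 := sat_sets_del U m.+3; have d2 := sat_sets_del U m.+2.
  have low := card_isolated_ge m.+2 (config_bicycle k3 Nn g) (config_ab k3 Nn g g).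
  rewrite -/S -/U in low.
  set Ng := #|_|%:R.
  have {}low : #|sat_sets U m.+2|%:R <= Ng by rewrite ler_nat.
  set L : R := (2 * n%:R) ^+ k in Ule.
  have L0 : 0 < L by rewrite exprn_gt0 // mulr_gt0 // ltr0n.
  set E' : R := (1 + p) ^+ _ in hal.
  have E0 : 0 < E' by rewrite exprn_gt0 // ltr_wpDr.
  have {}h1 : sig <= E' * #|sat_sets U m.+4|%:R.
    apply: le_trans h1 _; rewrite ler_wpM2r // ler_weXn2l // lerDl //.
  move: d1 d2; rewrite -!(ler_nat R) !natrM => d1 d2.
  have MU : m.+4%:R * m.+3%:R * #|sat_sets U m.+4|%:R <= Ng * L ^+ 2.
    rewrite -mulrA mulrCA; apply: (@le_trans _ _ (m.+3%:R * (#|sat_sets U m.+3|%:R * L))).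
      by rewrite ler_wpM2l //; apply: le_trans d1 _; rewrite ler_wpM2l.
    rewrite mulrA expr2 mulrA ler_wpM2r ?(ltW L0) //; apply: le_trans d2 _.
    by rewrite ler_pM.
  apply: (@le_trans _ _ (Q * (m.+4%:R * m.+3%:R) / L ^+ 2 / E' * (E' * #|sat_sets U m.+4|%:R))).
    apply: le_trans (ler_wpM2r sig0 hal) _.
    rewrite [(_ * _) ^+ (2 * k)](_ : _ = L ^+ 2); last by rewrite /L -exprM mulnC.
    apply: ler_wpM2l h1.
    apply: divr_ge0 (ltW E0); apply: divr_ge0; last exact/ltW/exprn_gt0.
    by rewrite !mulr_ge0.
  rewrite mulrA divfK ?gt_eqF // -!mulrA ler_wpM2l //.
  apply: le_trans (_ : m.+4%:R * m.+3%:R * #|sat_sets U m.+4|%:R / L ^+ 2 <= _).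
    by rewrite le_eqVlt; apply/orP; left; apply/eqP; ring.
  by rewrite ler_pdivrMr // exprn_gt0.
have upper : \sum_g \sum_h #|[set F in sat_sets W m.+4 | E g F && E h F]|%:R <= (be + be ^+ 2) * sig.
  have s2 : #|sat_sets W m.+2|%:R <= p ^+ 2 * sig.
    by have := sat_sets_addn R kapW mkap (i := 2) (subxx W) isT; rewrite !subSS subn0.
  have s4 : #|sat_sets W m|%:R <= p ^+ 4 * sig.
    by have := sat_sets_addn R kapW mkap (i := 4) (subxx W) isT; rewrite !subSS subn0.
  apply: (@le_trans _ _ (\sum_(g : {ffun 'I_(2 * k - 2) -> 'I_N}) (p ^+ 2 * sig + Q * (p ^+ 4 * sig)))).
    apply: ler_sum => g _; rewrite (bigD1 g) //= lerD //.
      apply: le_trans s2; rewrite ler_nat.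
      apply: leq_trans (card_config_isolated_le k3 Nn g m.+2); apply/subset_leq_card/subsetP => F.
      by rewrite !inE andbb.
    rewrite -card_g mulr_natl -sumr_const [leLHS]big_mkcond; apply: ler_sum => h _ /=.
    have x0 : 0 <= p ^+ 4 * sig by rewrite mulr_ge0 // exprn_ge0.
    case: eqVneq => //= hg; apply: le_trans s4; rewrite ler_nat.
    by apply: card_config_isolated2_le; rewrite // eq_sym.
  rewrite sumr_const -[leLHS]mulr_natl card_g.
  have -> : Q * (p ^+ 2 * sig + Q * (p ^+ 4 * sig)) = (Q * p ^+ 2 + (Q * p ^+ 2) ^+ 2) * sig by ring.
  rewrite ler_wpM2r // lerD // lerXn2r ?nnegrE ?(ltW be0) //.
  by rewrite mulr_ge0 // exprn_ge0.
have lower' : al * sig <= \sum_g #|[set F in sat_sets W m.+4 | E g F]|%:R.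
  have [Q00|Qn0] := eqVneq Q 0.
    apply: (@le_trans _ _ 0); last by apply: sumr_ge0.
    rewrite mulr_le0_ge0 //; apply: le_trans hal _.
    by rewrite Q00 !mul0r.
  have Qpos : 0 < Q by rewrite lt_def Qn0.
  rewrite -(ler_pM2l Qpos) mulr_sumr -{1}card_g mulr_natl -sumr_const; exact: ler_sum.
have bb : 0 < be + be ^+ 2 by rewrite addr_gt0 // exprn_gt0.
(* the value of lam that maximises 2 lam al - lam^2 (be + be^2) *)
pose lam := al / (be + be ^+ 2).
have lam0 : 0 <= lam by rewrite divr_ge0 // ltW.
apply: le_trans (second_moment (sat_sets W m.+4) E lam).
apply: (@le_trans _ _ (2 * lam * (al * sig) - lam ^+ 2 * ((be + be ^+ 2) * sig))).
  rewrite le_eqVlt; apply/orP; left; apply/eqP; rewrite /lam; field; exact: lt0r_neq0.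
by rewrite lerB // ler_wpM2l ?exprn_ge0 // mulr_ge0.
Qed.

Lemma expn_le_bin k s n : (2 * (s + k) <= n)%N ->
  (n ^ k <= 2 ^ k * k`! * 'C(n - s, k))%N.
Proof.
move=> sk; rewrite -mulnA [(k`! * _)%N]mulnC bin_ffact ffact_prod.
apply: (@leq_trans (2 ^ k * (n - s - k) ^ k)).
  have [->|k0] := posnP k; first by rewrite !expn0.
  rewrite -expnMn leq_exp2r //; lia.
rewrite leq_mul2l; apply/orP; right.
rewrite -[X in (_ ^ X)%N](card_ord k) -prod_nat_const; apply: leq_prod => i _.
by rewrite leq_sub2l // ltnW.
Qed.

(** For fixed k and r, the parameter p is at most b n^-(k-1), the total mass of
    the clauses meeting a configuration is bounded, and the number N^(2k-2) of
    configurations is of order n^(2k-2); so the constants al and be of the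
    finite version can be chosen independent of n. *)
Lemma isolated_config_positive_fraction (R : realType) k (r : R) :
  (3 <= k)%N -> 0 < r ->
  exists2 c : R, 0 < c & exists n0 : nat, forall n m : nat, (n0 <= n)%N ->
    r * n%:R <= m%:R <= (r + 1) * n%:R ->
    exists N (Nn : ((2 * k - 2) * N <= n)%N),
    c * #|sat_sets (kclauses k n) m|%:R <=
    #|[set F in sat_sets (kclauses k n) m |
        [exists g, isolated_in F (config_a Nn g) (config_b Nn g)]]|%:R.
Proof.
move=> k3 r0.
have k2 : k = k.-2.+2 by lia.
have kk : k = k.-1.+1 by lia.
pose s := (2 * k - 2)%N.
have s0 : (0 < s)%N by rewrite /s; lia.
(* 2 d n^k bounds the number of available satisfied clauses; half of it is
   left over for the clauses already present *)
pose d : R := (2 * (2 ^ k * k`!))%N%:R^-1.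
have d0 : 0 < d by rewrite invr_gt0 ltr0n !muln_gt0 expn_gt0 fact_gt0.
pose b := (r + 1) / d.
have b0 : 0 < b by rewrite divr_gt0 // ltr_wpDr.
pose al : R := r ^+ 2 / 2 / (2 * s%:R) ^+ s / 2 ^+ (2 * k) / expR (b * (s * 2 ^ k)%:R).
have al0 : 0 < al.
  by rewrite !divr_gt0 ?exprn_gt0 ?mulr_gt0 ?ltr0n ?expR_gt0.
have be0 : 0 < b ^+ 2 by rewrite exprn_gt0.
exists (al ^+ 2 / (b ^+ 2 + (b ^+ 2) ^+ 2)).
  by rewrite divr_gt0 ?addr_gt0 ?exprn_gt0.
(* beyond B there are at least 4 clauses, at most d n^k of them, and n is at
   least twice s + k, the loss in the binomial coefficient *)
pose B : R := 4 / r + (r + 1) / d + (2 * (s + k))%:R.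
exists (Num.Def.archi_bound B) => n m nB /andP[m1 m2].
have hB : B < n%:R.
  apply: (@lt_le_trans _ _ (Num.Def.archi_bound B)%:R); last by rewrite ler_nat.
  by apply: archi_boundP; rewrite !addr_ge0 // ?divr_ge0 ?ltW // addr_gt0.
have r4 : 0 < 4 / r by rewrite divr_gt0.
have rd : 0 < (r + 1) / d by [].
have skn : (2 * (s + k) <= n)%N.
  by rewrite -(ler_nat R); apply: ltW; apply: le_lt_trans hB; rewrite lerDr addr_ge0 // ltW.
have sk0 : 0 <= (2 * (s + k))%:R :> R by [].
have rn4 : 4 < r * n%:R by rewrite mulrC -ltr_pdivrMr //; rewrite /B in hB; lra.
have rdn : (r + 1) / d < n%:R by rewrite /B in hB; lra.
have sn : (s <= n)%N by apply: leq_trans skn; rewrite mul2n -addnn -addnA leq_addr.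
have n0 : (0 < n)%N by apply: leq_trans sn.
have x0 : 0 < n%:R :> R by rewrite ltr0n.
have x1 : 1 <= n%:R :> R by rewrite ler1n.
have m4 : (4 <= m)%N by rewrite -(ler_nat R); lra.
pose N := (n %/ s)%N.
have Nn : (s * N <= n)%N by rewrite mulnC leq_trunc_div.
exists N, Nn.
pose kap := 'C(n - s, k).
have kapE : 2 * d * n%:R ^+ k <= kap%:R.
  have := expn_le_bin skn; rewrite -/kap -(ler_nat R) natrX natrM => h.
  have -> : 2 * d = (2 ^ k * k`!)%N%:R^-1.
    by rewrite /d natrM invfM mulrA divff // mul1r.
  by rewrite mulrC ler_pdivrMr ?ltr0n ?muln_gt0 ?expn_gt0 ?fact_gt0 // mulrC.
have mkap : m%:R <= d * n%:R ^+ k.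
  apply: le_trans m2 _.
  have -> : n%:R ^+ k = n%:R * n%:R * n%:R ^+ k.-2 :> R by rewrite {1}k2 !exprS mulrA.
  apply: (@le_trans _ _ (d * n%:R * n%:R)).
    by rewrite ler_wpM2r // mulrC -ler_pdivrMr // ltW.
  by rewrite !mulrA ler_peMr ?mulr_ge0 ?(ltW d0) // exprn_ege1.
have dn0 : 0 < d * n%:R ^+ k by rewrite mulr_gt0 // exprn_gt0.
have mltkap : (m < kap)%N by rewrite -(ltr_nat R); lra.
have kapm : d * n%:R ^+ k <= (kap - m)%:R by rewrite natrB ?(ltnW mltkap) //; lra.
pose p : R := m%:R / (kap - m)%:R.
have p0 : 0 <= p by rewrite divr_ge0.
have pb : p * n%:R ^+ k.-1 <= b.
  rewrite /p mulrAC ler_pdivrMr; last by apply: lt_le_trans kapm.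
  apply: (@le_trans _ _ (b * (d * n%:R ^+ k))); last by rewrite ler_wpM2l // ltW.
  have -> : n%:R ^+ k = n%:R * n%:R ^+ k.-1 :> R by rewrite -exprS -kk.
  rewrite [leRHS]mulrA {1}/b divfK ?gt_eqF // [leRHS]mulrA.
  by rewrite ler_wpM2r // exprn_ge0.
have T : (1 + p) ^+ (s * (2 * (2 * n) ^ k.-1)) <= expR (b * (s * 2 ^ k)%:R).
  apply: (@le_trans _ _ (expR p ^+ (s * (2 * (2 * n) ^ k.-1)))).
    rewrite lerXn2r ?nnegrE ?expR_ge0 ?expR_ge1Dx //; exact: addr_ge0.
  rewrite -expRM_natl ler_expR expnMn.
  have -> : (s * (2 * (2 ^ k.-1 * n ^ k.-1)) = s * 2 ^ k * n ^ k.-1)%N.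
    by rewrite (_ : 2 ^ k = 2 * 2 ^ k.-1)%N ?mulnA // -expnS -kk.
  by rewrite natrM natrX mulrAC -mulrA [leRHS]mulrC ler_wpM2l.
have NE : n%:R / (2 * s%:R) <= N%:R :> R.
  rewrite ler_pdivrMr ?mulr_gt0 ?ltr0n // -!natrM ler_nat.
  have nN := ltn_ceil n s0; have N0 : (0 < N)%N by rewrite divn_gt0.
  apply: leq_trans (ltnW nN) _; rewrite mulnA leq_mul2r muln2 -addnn -/N.
  by rewrite -[X in (X <= _)%N]addn1 leq_add2l N0 orbT.
have Nle : N%:R <= n%:R :> R by rewrite ler_nat leq_div.
move: m m1 m2 m4 @p p0 pb T mkap mltkap kapm.
case=> [|[|[|[|m]]]] // m1 m2 _ p p0 pb T mkap mltkap kapm.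
apply: (isolated_config_fraction k3 (kap := kap)) => //; last exact: ltW.
  apply: (@le_trans _ _ ((n%:R / (2 * s%:R)) ^+ s * (r * n%:R * (r * n%:R / 2)) / (2 * n%:R) ^+ (2 * k) /
     expR (b * (s * 2 ^ k)%:R))).
    rewrite le_eqVlt; apply/orP; left; apply/eqP; rewrite /al expr_div_n [(2 * n%:R) ^+ _]exprMn.
    have -> : n%:R ^+ (2 * k) = n%:R ^+ s * n%:R ^+ 2 :> R.
      by rewrite -exprD; congr (_ ^+ _); rewrite /s; clear -k3; lia.
    have : n%:R ^+ s != 0 :> R by rewrite expf_neq0 // gt_eqF.
    have : (2 * s%:R) ^+ s != 0 :> R by rewrite expf_neq0 // mulf_neq0 // pnatr_eq0 -lt0n.
    have : 2 ^+ (2 * k) != 0 :> R by rewrite expf_neq0.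
    have := expR_gt0 (b * (s * 2 ^ k)%:R); move: x0.
    move: n%:R (n%:R ^+ s) ((2 * s%:R) ^+ s) (2 ^+ (2 * k)) (expR _) => x t3 t2 t1 e x0 e0 h1 h2 h3.
    by field; rewrite h1 h2 h3 !gt_eqF.
  have F0 : 0 < (1 + p) ^+ (s * (2 * (2 * n) ^ k.-1)) by rewrite exprn_gt0 // ltr_wpDr.
  have D0 : 0 <= ((2 * n%:R) ^+ (2 * k))^-1 :> R by rewrite invr_ge0 exprn_ge0 // mulr_ge0.
  have xs0 : 0 <= n%:R / (2 * s%:R) :> R by rewrite divr_ge0 // mulr_ge0.
  have rx : 0 <= r * n%:R by rewrite mulr_ge0 // ltW.
  have rx2 : 0 <= r * n%:R / 2 by rewrite divr_ge0.
  have xss0 : 0 <= (n%:R / (2 * s%:R)) ^+ s :> R by rewrite exprn_ge0.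
  have rxx : 0 <= r * n%:R * (r * n%:R / 2) by rewrite mulr_ge0.
  have mm : r * n%:R * (r * n%:R / 2) <= m.+4%:R * m.+3%:R.
    rewrite ler_pM // ?divr_ge0 //.
    by move: m1 rn4; rewrite -[m.+4%:R]natr1; lra.
  apply: ler_pM => //.
  - by apply: (mulr_ge0 _ D0); apply: mulr_ge0.
  - apply: (ler_wpM2r D0); apply: ler_pM => //; by rewrite lerXn2r ?nnegrE.
  - by rewrite lef_pV2 ?posrE ?expR_gt0.
apply: (@le_trans _ _ ((p * n%:R ^+ k.-1) ^+ 2)).
  rewrite [leRHS]exprMn [leRHS]mulrC -exprM; apply: ler_wpM2r; first exact: exprn_ge0.
  rewrite (_ : k.-1 * 2 = s)%N; last by rewrite /s; clear -k3; lia.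
  by rewrite lerXn2r ?nnegrE.
have px0 : 0 <= p * n%:R ^+ k.-1 by rewrite mulr_ge0 ?exprn_ge0.
by apply: lerXn2r pb; rewrite nnegrE // ltW.
Qed.

(** * Refutation of the hypothesis *)

Lemma num_clauses_bounds (R : realType) k (rho : R) n :
  let r := 2 ^+ k * rho / k%:R in (0 < k)%N -> 0 < rho -> (0 < n)%N ->
  r * n%:R <= (num_clauses k rho n)%:R <= (r + 1) * n%:R.
Proof.
move=> r k0 rho0 n0; rewrite /num_clauses -/r.
have r0 : 0 < r by rewrite divr_gt0 ?ltr0n // mulr_gt0 // exprn_gt0.
have /andP[h1 h2] := ceil_itv (r * n%:R).
have c0 : (0 <= Num.ceil (r * n%:R))%R.
  by rewrite -(ler_int R); apply: le_trans h2; rewrite mulr_ge0 // ltW.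
rewrite natr_absz ger0_norm // h2 /=.
have n1 : 1 <= n%:R :> R by rewrite ler1n.
by move: h1; rewrite intrB; lra.
Qed.

Theorem corollary2p8 (R : realType) :
  exists (c0 : R) (k0 : nat) (rho0 : R),
    [/\ 0 < c0, (0 < k0)%N & 0 < rho0] /\
    forall (k : nat) (rho : R),
      (3 <= k)%N -> (k0 <= k)%N ->
      rho0 <= rho -> rho <= k%:R * ln 2 - 3 * ln k%:R ->
      ~ BP_hypothesis k rho.
Proof.
exists 1, 1%N, 1; split=> // k rho k3 _ rho1 _ hyp.
have rho0 : 0 < rho by apply: lt_le_trans rho1.
have kpos : (0 < k)%N by apply: leq_trans k3.
pose r : R := 2 ^+ k * rho / k%:R.
have r0 : 0 < r by rewrite divr_gt0 ?ltr0n // mulr_gt0 // exprn_gt0.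
have [c c0 [n0 frac]] := isolated_config_positive_fraction k3 r0.
pose eps : R := (2^-1 ^+ (k - 2)) ^+ 3 / 128.
have eps0 : 0 < eps by rewrite divr_gt0 // !exprn_gt0 // invr_gt0.
have [omega [_ cvg]] := hyp eps eps0.
pose c' := Num.min c 1.
have c'0 : 0 < c' by rewrite lt_min c0 ltr01.
have : \forall n \near \oo%classic,
    process_prob R k (num_clauses k rho n) (@BP_accurate R n eps (omega n)) <= 1 - c'.
  near=> n.
  have nn0 : (n0 <= n)%N by near: n; exact: nbhs_infty_ge.
  have n1 : (0 < n)%N by near: n; exact: nbhs_infty_gt.
  have [N [Nn]] := frac n _ nn0 (num_clauses_bounds kpos rho0 n1).
  set B := [set F in _ | _] => hB.
  apply: (process_prob_le (B := B)) => [|F s|].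
  - by rewrite ge_min lexx orbT.
  - rewrite inE => /andP[_ /existsP[g iso]].
    exact: isolated_bicycle_not_accurate k3 (config_ab k3 _ _ _) (config_bicycle k3 _ _) iso.
  - rewrite -/(sat_sets _ _) (setIidPr _); last by apply/subsetP => F; rewrite inE => /andP[].
    by apply: le_trans hB; rewrite ler_wpM2r // ge_min lexx.
have lt1 : 1 - c' < 1 by rewrite ltrBlDr ltrDl.
move=> le_near; have gt_near : \forall n \near \oo%classic,
    1 - c' < process_prob R k (num_clauses k rho n) (@BP_accurate R n eps (omega n)).
  by apply: cvgr_gt cvg _ lt1.
have [n] := filter_ex (filterI le_near gt_near).
by move=> [h1 h2]; move: (le_lt_trans h1 h2); rewrite ltxx.
Unshelve. all: by end_near.
Qed.
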